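(* Let $D=(Ele,Rg,rt)$ be a DTD and $P=(\mathcal A,\mathcal F)$ a policy over $D$. Then $P$ is consistent if and only if all of the following hold: (1) for every $A\in Ele$ with $Rg(A)=B^*$: if $(A,\mathsf{insert}(B))\in\mathcal A$ and $(A,\mathsf{delete}(B))\in\mathcal A$, then nothing is forbidden below $B$ in $P$; (2) for every $A\in Ele$ with $Rg(A)=B_1+\dots+B_n$: no edge $(B_i,B_j)$ of $G_A^+$ belongs to $F_A$; (3) for every $A\in Ele$ with $Rg(A)=B_1+\dots+B_n$ and every $i\in\{1,\dots,n\}$: if $B_i$ lies on a (directed) cycle of $G_A$, then nothing is forbidden below $B_i$ in $P$.
   Context: Let $\mathcal L$ be an infinite set of labels and $\mathsf{str}\notin\mathcal L$ a special symbol. A DTD is a triple $D=(Ele,Rg,rt)$ where $Ele\subseteq\mathcal L$ is finite, $rt\in Ele$ is the root type, and for each $A\in Ele$, $Rg(A)$ is one of: $\mathsf{str}$, $\epsilon$, $B_1,\dots,B_n$ (concatenation), $B_1+\dots+B_n$ (disjunction), or $B_1^*$ (Kleene star), where the $B_i\in Ele$ are pairwise distinct and are called subelement types of $A$. DTDs are non-recursive: the directed graph on $Ele$ with an edge $A\to B$ whenever $B$ is a subelement type of $A$ is acyclic. $\le_D$ denotes the reflexive–transitive closure of the subelement relation. We assume every element type is reachable from the root: $rt\le_D A$ for all $A\in Ele$. An XML tree is $t=(N_t,E_t,\lambda_t,r_t,v_t)$: a finite rooted unordered tree with node set $N_t$, parent–child edge set $E_t$, root $r_t$, labelling $\lambda_t:N_t\to\mathcal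 L\cup\{\mathsf{str}\}$, and a function $v_t$ assigning a string to each node labelled $\mathsf{str}$. The tree $t$ conforms to $D$ at $A\in Ele$ if $\lambda_t(r_t)=A$, every node is labelled by an element of $Ele\cup\{\mathsf{str}\}$, every node labelled $B\in Ele$ has children whose labels, listed in some order, form a word of the language of the regular expression $Rg(B)$ (with $Rg(B)=\mathsf{str}$ meaning a single child labelled $\mathsf{str}$ and $\epsilon$ meaning no children), and every node labelled $\mathsf{str}$ is a leaf with a defined string value. $I_D(A)$ is the set of trees conforming to $D$ at $A$, and $I_D=I_D(rt)$. Trees $t_1,t_2$ are isomorphic, $t_1\equiv t_2$, if there is a bijection $N_{t_1}\to N_{t_2}$ preserving root, edges, labels and string values. Atomic updates on a tree $t$: $\mathsf{insert}(n,t')$ adds the tree $t'$ with its root as a new child of $n$; $\mathsf{delete}(n)$ removes $n$ and all its descendants; $\mathsf{replace}(n,t')$ removes the subtree rooted at $n$ and attaches $t'$ (by its root) as a child of the former parent of $n$; $\mathsf{replace}(n,s)$, for a string $s$, sets the string value of $n$ to $s$. An update is valid on $t$ if $n\in N_t$ and the tree $t'$ (if present) has node set disjoint from $N_t$; $[\![op]\!](t)$ denotes the result. For a sequence, $[\![op_1;\dots;op_k]\!](t)=[\![op_k]\!](\cdots[\![op_1]\!](t)\cdots)$, and the sequence is valid on $t$ if each $op_i$ is valid on the result of $op_1;\dots;op_{i-1}$. Update access types (UATs) are expressions $(A,\mathsf{insert}(B))$, $(A,\mathsf{delete}(B))$, $(A,\mathsf{replace}(B,B'))$ with $B\neq B'$,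 and $(A,\mathsf{replace}(\mathsf{str},\mathsf{str}))$, with $A\in Ele$; $A$ is the element type of the UAT. Such a UAT is valid for $D$ iff, respectively: $Rg(A)=B^*$; $Rg(A)=B^*$; $Rg(A)=B_1+\dots+B_n$ with $B,B'\in\{B_1,\dots,B_n\}$, $B\neq B'$; $Rg(A)=\mathsf{str}$. $\mathrm{valid}(D)$ is the set of UATs valid for $D$. An atomic update matches a UAT on $t$ as follows: $\mathsf{insert}(n,t')$ matches $(A,\mathsf{insert}(B))$ if $\lambda_t(n)=A$ and $t'\in I_D(B)$; $\mathsf{delete}(n)$ matches $(A,\mathsf{delete}(B))$ if $\lambda_t(n)=B$ and the parent of $n$ is labelled $A$; $\mathsf{replace}(n,t')$ matches $(A,\mathsf{replace}(B,B'))$ if $\lambda_t(n)=B$, the parent of $n$ is labelled $A$, $t'\in I_D(B')$ and $B\neq B'$; $\mathsf{replace}(n,s)$ matches $(A,\mathsf{replace}(\mathsf{str},\mathsf{str}))$ if $\lambda_t(n)=\mathsf{str}$ and the parent of $n$ is labelled $A$. For a set $S$ of UATs, $[\![S]\!]_t$ is the set of atomic updates matching some element of $S$ on $t$. A sequence $op_1;\dots;op_k$ is allowed on $t$ by $S$ if it is valid on $t$ and $op_i\in[\![S]\!]_{t_{i-1}}$ for all $i$, where $t_0=t$ and $t_i=[\![op_i]\!](t_{i-1})$. A policy over $D$ is a pair $P=(\mathcal A,\mathcal F)$ with $\mathcal A,\mathcal F\subseteq\mathrm{valid}(D)$ and $\mathcal A\cap\mathcal F=\emptyset$ (allowed and forbidden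 UATs); it is total if $\mathcal A\cup\mathcal F=\mathrm{valid}(D)$ and partial otherwise. $P$ is consistent if there exist no $t\in I_D$, no sequence $op_1;\dots;op_k$ ($k\ge1$) allowed on $t$ by $\mathcal A$, and no $op_0\in[\![\mathcal F]\!]_t$ valid on $t$ and non-trivial (i.e. $[\![op_0]\!](t)\not\equiv t$) such that $[\![op_1;\dots;op_k]\!](t)\equiv[\![op_0]\!](t)$. Nothing is forbidden below $B$ in $P=(\mathcal A,\mathcal F)$ means: $\mathcal F$ contains no UAT whose element type $C$ satisfies $B\le_D C$. For $A$ with $Rg(A)=B_1+\dots+B_n$, the replace graph $G_A$ is the directed graph with vertices $B_1,\dots,B_n$ and an edge $(B_i,B_j)$ iff $(A,\mathsf{replace}(B_i,B_j))\in\mathcal A$; $G_A^+$ is its transitive closure; and $F_A=\{(B_i,B_j)\mid (A,\mathsf{replace}(B_i,B_j))\in\mathcal F\}$ is the set of forbidden edges of $A$. *)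

(* Defs.v *)
From mathcomp Require Import all_boot.
From Stdlib Require Import Relations.
Set Implicit Arguments. Unset Strict Implicit. Unset Printing Implicit Defensive.

(* Labels: the infinite set L is taken to be nat.  A node label is an
   element of L ∪ {str}, represented as [option nat] with [None] = str. *)
Definition Lab := option nat.
Definition Str : Lab := None.
Definition El (a : nat) : Lab := Some a.
(* String values: taken from an infinite set, represented by nat. *)
Definition strval := nat.

Inductive rhs :=
| RStr
| REps
| RCat of seq nat
| RDisj of seq nat
| RStar of nat.

Definition rhs_kids (r : rhs) : seq nat :=
  match r with
  | RStr | REps => [::]
  | RCat bs | RDisj bs => bs
  | RStar b => [:: b]
  end.

Record dtd := DTD { Ele : seq nat; Rg : nat -> rhs; rt : nat }.

Definition subel (D : dtd) (A B : nat) : Prop :=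
  A \in Ele D /\ B \in rhs_kids (Rg D A).

Definition leD (D : dtd) : nat -> nat -> Prop := clos_refl_trans nat (subel D).

Definition wf_rhs (D : dtd) (r : rhs) : Prop :=
  match r with
  | RStr | REps => True
  | RCat bs | RDisj bs => bs != [::] /\ uniq bs /\ all (fun b => b \in Ele D) bs
  | RStar b => b \in Ele D
  end.

Definition wf_dtd (D : dtd) : Prop :=
  rt D \in Ele D /\
  (forall A, A \in Ele D -> wf_rhs D (Rg D A)) /\
  (forall A, ~ clos_trans nat (subel D) A A) /\
  (forall A, A \in Ele D -> leD D (rt D) A).

Record tree := Tree {
  nodes : seq nat;
  edges : seq (nat * nat);          (* (parent, child) *)
  lab   : nat -> Lab;
  sval  : nat -> strval;
  root  : nat }.

Definition edge_rel (t : tree) (x y : nat) : Prop := (x, y) \in edges t.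

Definition is_tree (t : tree) : Prop :=
  uniq (nodes t) /\ uniq (edges t) /\ root t \in nodes t /\
  (forall e, e \in edges t -> (e.1 \in nodes t) && (e.2 \in nodes t)) /\
  count (fun e => e.2 == root t) (edges t) = 0 /\
  (forall x, x \in nodes t -> x != root t ->
     count (fun e => e.2 == x) (edges t) = 1) /\
  (forall x, x \in nodes t -> clos_refl_trans nat (edge_rel t) (root t) x).

Definition children (t : tree) (x : nat) : seq nat :=
  [seq e.2 | e <- edges t & e.1 == x].

Definition word_ok (r : rhs) (ls : seq Lab) : Prop :=
  match r with
  | RStr => ls = [:: Str]
  | REps => ls = [::]
  | RCat bs => perm_eq ls (map El bs)
  | RDisj bs => exists2 b, b \in bs & ls = [:: El b]
  | RStar b => all (fun l => l == El b) ls
  end.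

Definition conforms (D : dtd) (A : nat) (t : tree) : Prop :=
  is_tree t /\ lab t (root t) = El A /\
  forall x, x \in nodes t ->
    match lab t x with
    | None => children t x = [::]
    | Some B => B \in Ele D /\ word_ok (Rg D B) (map (lab t) (children t x))
    end.

Definition iso (t1 t2 : tree) : Prop :=
  exists f : nat -> nat,
    (forall x, x \in nodes t1 -> f x \in nodes t2) /\
    (forall y, y \in nodes t2 -> exists2 x, x \in nodes t1 & f x = y) /\
    {in nodes t1 &, injective f} /\
    f (root t1) = root t2 /\
    (forall x y, x \in nodes t1 -> y \in nodes t1 ->
       ((x, y) \in edges t1) = ((f x, f y) \in edges t2)) /\
    (forall x, x \in nodes t1 -> lab t2 (f x) = lab t1 x) /\
    (forall x, x \in nodes t1 -> lab t1 x = Str -> sval t2 (f x) = sval t1 x).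

Inductive op :=
| Ins of nat & tree
| Del of nat
| Repl of nat & tree
| ReplS of nat & strval.

Fixpoint anc (E : seq (nat * nat)) (k : nat) (n x : nat) : bool :=
  (x == n) ||
  (if k is k'.+1 then has (fun e => (e.2 == x) && anc E k' n e.1) E else false).

(* x is a descendant of n (or n itself); paths in a tree have at most |E| edges *)
Definition desc (t : tree) (n x : nat) : bool := anc (edges t) (size (edges t)) n x.

Definition parent (t : tree) (n : nat) : nat :=
  head n [seq e.1 | e <- edges t & e.2 == n].

Definition do_insert (t : tree) (n : nat) (t' : tree) : tree :=
  {| nodes := nodes t ++ nodes t';
     edges := edges t ++ edges t' ++ [:: (n, root t')];
     lab := fun x => if x \in nodes t' then lab t' x else lab t x;
     sval := fun x => if x \in nodes t' then sval t' x else sval t x;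
     root := root t |}.

Definition do_delete (t : tree) (n : nat) : tree :=
  {| nodes := [seq x <- nodes t | ~~ desc t n x];
     edges := [seq e <- edges t | ~~ desc t n e.1 && ~~ desc t n e.2];
     lab := lab t; sval := sval t; root := root t |}.

Definition apply (o : op) (t : tree) : tree :=
  match o with
  | Ins n t' => do_insert t n t'
  | Del n => do_delete t n
  | Repl n t' => do_insert (do_delete t n) (parent t n) t'
  | ReplS n s =>
      {| nodes := nodes t; edges := edges t; lab := lab t;
         sval := fun x => if x == n then s else sval t x; root := root t |}
  end.

Definition apply_seq (ops : seq op) (t : tree) : tree :=
  foldl (fun t o => apply o t) t ops.

Definition disjoint_from (t' t : tree) : Prop :=
  all (fun x => x \notin nodes t) (nodes t').

Definition valid_op (t : tree) (o : op) : Prop :=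
  match o with
  | Ins n t' | Repl n t' => n \in nodes t /\ disjoint_from t' t
  | Del n | ReplS n _ => n \in nodes t
  end.

Inductive uat :=
| UIns of nat & nat              (* (A, insert(B)) *)
| UDel of nat & nat              (* (A, delete(B)) *)
| URepl of nat & nat & nat       (* (A, replace(B, B')) *)
| UReplS of nat.                 (* (A, replace(str, str)) *)

Definition uat_el (u : uat) : nat :=
  match u with UIns A _ | UDel A _ | URepl A _ _ | UReplS A => A end.

Definition valid_uat (D : dtd) (u : uat) : Prop :=
  match u with
  | UIns A B | UDel A B => A \in Ele D /\ Rg D A = RStar B
  | URepl A B B' => A \in Ele D /\ B != B' /\
      exists2 bs, Rg D A = RDisj bs & (B \in bs) && (B' \in bs)
  | UReplS A => A \in Ele D /\ Rg D A = RStr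
  end.

Definition parent_lab (t : tree) (n A : nat) : Prop :=
  exists2 p, (p, n) \in edges t & lab t p = El A.

Definition matches (D : dtd) (t : tree) (o : op) (u : uat) : Prop :=
  match o, u with
  | Ins n t', UIns A B => lab t n = El A /\ conforms D B t'
  | Del n, UDel A B => lab t n = El B /\ parent_lab t n A
  | Repl n t', URepl A B B' =>
      lab t n = El B /\ parent_lab t n A /\ conforms D B' t' /\ B <> B'
  | ReplS n _, UReplS A => lab t n = Str /\ parent_lab t n A
  | _, _ => False
  end.

Definition in_sem (D : dtd) (S : uat -> Prop) (t : tree) (o : op) : Prop :=
  exists2 u, S u & matches D t o u.

Fixpoint allowed (D : dtd) (S : uat -> Prop) (t : tree) (ops : seq op) : Prop :=
  match ops with
  | [::] => True
  | o :: ops' => valid_op t o /\ in_sem D S t o /\ allowed D S (apply o t) ops'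
  end.

Definition policy (D : dtd) (Aset Fset : uat -> Prop) : Prop :=
  (forall u, Aset u -> valid_uat D u) /\
  (forall u, Fset u -> valid_uat D u) /\
  (forall u, Aset u -> Fset u -> False).

Definition consistent (D : dtd) (Aset Fset : uat -> Prop) : Prop :=
  ~ exists (t : tree) (ops : seq op) (o0 : op),
      conforms D (rt D) t /\ ops <> [::] /\ allowed D Aset t ops /\
      valid_op t o0 /\ in_sem D Fset t o0 /\
      ~ iso (apply o0 t) t /\
      iso (apply_seq ops t) (apply o0 t).

Definition nothing_forbidden_below (D : dtd) (Fset : uat -> Prop) (B : nat) : Prop :=
  forall u, Fset u -> ~ leD D B (uat_el u).

Definition replace_edge (D : dtd) (Aset : uat -> Prop) (A : nat) (Bi Bj : nat) : Prop :=
  (exists2 bs, Rg D A = RDisj bs & (Bi \in bs) && (Bj \in bs)) /\ Aset (URepl A Bi Bj).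

(* Main.v *)
Require Import Defs.
From mathcomp Require Import all_boot.
From Stdlib Require Import Relations.

(** Up to isomorphism, an XML tree is a finite tree with multisets of children,
    and it has a canonical form ([utree]) in which siblings are sorted, so that
    isomorphism becomes equality of canonical forms and an atomic update becomes
    a rewriting step ([step]) at some node.

    If (1)-(3) hold, a forbidden step [T -> T'] with [T <> T'] is never a sequence
    of allowed steps, by induction on the depth of the forbidden step.  Suppose it
    happens inside the child [k] of the root, turning it into [k'].  Since the
    number and the labels of the children are unchanged, insertions and deletions,
    or a cycle of replacements, at the root would violate (1) or (3); so the
    allowed steps act inside the children and yield a matching between the
    children [k :: ks] and [k' :: ks].  Following the cycle of this permutation
    through [k] gives allowed steps from [k] to [k'].

    Conversely, if (1) or (3) fails at [A], a subtree below [A] can be thrown away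
    and replaced by the result of a forbidden update on it, and if (2) fails a
    forbidden replacement is a chain of allowed ones. *)

Set Implicit Arguments. Unset Strict Implicit. Unset Printing Implicit Defensive.

(* Both names are shadowed by MathComp. *)
Local Notation root := Defs.root.
Local Notation sval := Defs.sval.

(** * Canonical forms and rewriting steps *)

Lemma perm_eq_seq1 (T : eqType) (s : seq T) x : perm_eq s [:: x] -> s = [:: x].
Proof. exact: perm_small_eq. Qed.

Definition utree := GenTree.tree nat.

(** The order of the [pickle] codes is arbitrary. It serves only because it is total and
    antisymmetric, which makes sorting a normal form for multisets. *)
Definition leu : rel utree := fun x y => pickle x <= pickle y.

Lemma leu_total : total leu.
Proof. by move=> x y; apply: leq_total. Qed.

Lemma leu_trans : ssrbool.transitive leu.
Proof. by move=> x y z; apply: leq_trans. Qed.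

Lemma leu_anti : ssrbool.antisymmetric leu.
Proof.
move=> x y /anti_leq H; apply: (pcan_inj (@pickleK _)); exact: H.
Qed.

(** Label and string value share one node code. Canonical forms are built with [mk] only, so the
    default values in [lbl] are never met on them. *)
Definition mk (l : Lab) (s : strval) (ks : seq utree) : utree :=
  GenTree.Node (pickle (l, s)) (sort leu ks).

Definition lbl (T : utree) : Lab :=
  if T is GenTree.Node n _ then
    if (unpickle n : option (Lab * strval)) is Some p then p.1 else Str
  else Str.

#[global] Arguments mk : simpl never.
#[global] Arguments lbl : simpl never.

Lemma lbl_mk l s ks : lbl (mk l s ks) = l.
Proof. by rewrite /lbl /mk pickleK. Qed.

Lemma mk_perm l s ks ks' : perm_eq ks ks' -> mk l s ks = mk l s ks'.
Proof. by move/(perm_sortP leu_total leu_trans leu_anti) => H; rewrite /mk H. Qed.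

Lemma mk_inj l s ks l' s' ks' :
  mk l s ks = mk l' s' ks' -> [/\ l = l', s = s' & perm_eq ks ks'].
Proof.
case=> /(pcan_inj (@pickleK _)) [-> ->] H; split=> //.
exact/(perm_sortP leu_total leu_trans leu_anti).
Qed.

(** An element node has no string value; fixing the slot to 0 keeps isomorphic trees equal. *)
Notation nd A ks := (mk (El A) 0 ks).
Notation leaf s := (mk Str s [::]).

Lemma word_ok_perm r ls ls' : perm_eq ls ls' -> word_ok r ls -> word_ok r ls'.
Proof.
case: r => [||bs|bs|b] /= H.
- by move=> E; move: H; rewrite E perm_sym => /perm_small_eq ->.
- by move=> E; move: H; rewrite E perm_sym => /perm_small_eq ->.
- by move=> E; apply: perm_trans E; rewrite perm_sym.
- case=> b b_in E; exists b => //.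
  by move: H; rewrite E perm_sym => /perm_small_eq ->.
- by rewrite (perm_all _ H).
Qed.

Section Steps.

Variable D : dtd.

Inductive conf : utree -> Prop :=
| ConfStr s : conf (leaf s)
| ConfEl A ks : A \in Ele D -> word_ok (Rg D A) (map lbl ks) ->
    (forall k, k \in ks -> conf k) -> conf (nd A ks).

(** Since [mk] is not a constructor, inversion goes through [mk_inj] and yields the children only up
    to permutation. *)
Lemma conf_nd A ks : conf (nd A ks) ->
  [/\ A \in Ele D, word_ok (Rg D A) (map lbl ks) & forall k, k \in ks -> conf k].
Proof.
move E: (nd A ks) => T c; case: c E => [s /mk_inj[]//|A' ks' HA Hw Hk].
case/mk_inj=> [[->] _ Hp]; split=> // [|k].
  by apply: word_ok_perm Hw; rewrite perm_sym perm_map.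
by rewrite (perm_mem Hp); apply: Hk.
Qed.

(** The head of the list stands for an arbitrary child, because [mk] does not see the order of
    siblings. *)
Inductive step (S : uat -> Prop) : utree -> utree -> Prop :=
| StepIns A B k ks : S (UIns A B) -> lbl k = El B -> conf k ->
    step S (nd A ks) (nd A (k :: ks))
| StepDel A B k ks : S (UDel A B) -> lbl k = El B ->
    step S (nd A (k :: ks)) (nd A ks)
| StepRepl A B B' k k' ks : S (URepl A B B') ->
    lbl k = El B -> lbl k' = El B' -> conf k' ->
    step S (nd A (k :: ks)) (nd A (k' :: ks))
| StepStr A s s' ks : S (UReplS A) ->
    step S (nd A (leaf s :: ks)) (nd A (leaf s' :: ks))
| StepCtx A k k' ks : step S k k' ->
    step S (nd A (k :: ks)) (nd A (k' :: ks)).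

(** A step read on the multisets of children, keeping only what the invariant [evolved] needs. *)
Variant kstep (S : uat -> Prop) A (ks ks' : seq utree) : Prop :=
| KIns B k of S (UIns A B) & lbl k = El B & conf k & perm_eq ks' (k :: ks)
| KDel B k of S (UDel A B) & lbl k = El B & perm_eq ks (k :: ks')
| KRepl B B' k k' ks0 of S (URepl A B B') & lbl k = El B & lbl k' = El B'
    & perm_eq ks (k :: ks0) & perm_eq ks' (k' :: ks0)
| KStr of S (UReplS A)
| KCtx k k' ks0 of step S k k' & perm_eq ks (k :: ks0) & perm_eq ks' (k' :: ks0).

Lemma step_nd S A ks Y : step S (nd A ks) Y ->
  exists2 ks', Y = nd A ks' & kstep S A ks ks'.
Proof.
move E: (nd A ks) => T c; case: c E.
- move=> A' B k ks' HS Hl Hc /mk_inj[[EA] _ Hp]; subst A'; exists (k :: ks') => //.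
  by apply: (KIns HS Hl Hc); rewrite perm_cons perm_sym.
- by move=> A' B k ks' HS Hl /mk_inj[[EA] _ Hp]; subst A'; exists ks' => //; exact: (KDel HS Hl).
- move=> A' B B' k k' ks' HS Hl Hl' Hc /mk_inj[[EA] _ Hp]; subst A'.
  exists (k' :: ks') => //.
  by apply: (KRepl HS Hl Hl' Hp).
- by move=> A' s s' ks' HS /mk_inj[[EA] _ Hp]; subst A'; exists (leaf s' :: ks') => //; exact: KStr.
- move=> A' k k' ks' Hs /mk_inj[[EA] _ Hp]; subst A'; exists (k' :: ks') => //.
  by apply: (KCtx _ Hs Hp).
Qed.

Lemma step_lbl S T T' : step S T T' -> lbl T' = lbl T.
Proof. by case=> *; rewrite !lbl_mk. Qed.

Lemma step_leaf S s T : ~ step S (leaf s) T.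
Proof. by move E: (leaf s) => U c; case: c E => *;
  match goal with H : mk _ _ _ = mk _ _ _ |- _ => case: (mk_inj H) end.
Qed.

Lemma step_mono (S S' : uat -> Prop) T T' :
  (forall u, S u -> S' u) -> step S T T' -> step S' T T'.
Proof.
move=> sub; elim=> [A B k ks|A B k ks|A B B' k k' ks|A s s' ks|A k k' ks].
- by move=> /sub HS Hl Hc; apply: StepIns HS Hl Hc.
- by move=> /sub HS Hl; apply: StepDel HS Hl.
- by move=> /sub HS Hl Hl' Hc; apply: StepRepl HS Hl Hl' Hc.
- by move=> /sub HS; apply: StepStr HS.
- by move=> _; apply: StepCtx.
Qed.

Section Valid.
Variable S : uat -> Prop.
Hypothesis S_valid : forall u, S u -> valid_uat D u.

Lemma step_conf T T' : step S T T' -> conf T -> conf T'.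
Proof.
elim=> {T T'} [A B k ks|A B k ks|A B B' k k' ks|A s s' ks|A k k' ks].
- move=> /S_valid[_ HR] Hl Hc /conf_nd[HA Hw Hk]; apply: ConfEl => //.
    by move: Hw; rewrite HR /= Hl eqxx.
  by move=> k0; rewrite inE => /predU1P[-> //|/Hk].
- move=> /S_valid[_ HR] Hl /conf_nd[HA Hw Hk]; apply: ConfEl => //.
    by move: Hw; rewrite HR /= => /andP[].
  by move=> k0 H; apply: Hk; rewrite inE H orbT.
- move=> /S_valid[_ [_ [bs HR /andP[_ HB']]]] Hl Hl' Hc /conf_nd[HA Hw Hk].
  (* A word of a disjunction has length one, so the replaced child has no siblings. *)
  move: Hw; rewrite HR /= => -[b b_in [_ /(congr1 size)]].
  rewrite size_map => /size0nil E; rewrite E in Hk *.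
  apply: ConfEl => //; first by rewrite HR /=; exists B' => //; rewrite Hl'.
  by move=> k0; rewrite inE => /eqP->.
- move=> /S_valid[_ HR] /conf_nd[HA Hw Hk]; apply: ConfEl => //.
    by move: Hw; rewrite HR /= !lbl_mk.
  move=> k; rewrite inE => /predU1P[->|Hin]; first exact: ConfStr.
  by apply: Hk; rewrite inE Hin orbT.
- move=> Hs IH /conf_nd[HA Hw Hk]; apply: ConfEl => //.
    by move: Hw; rewrite /= (step_lbl Hs).
  move=> k0; rewrite inE => /predU1P[->|Hin].
    by apply: IH; apply: Hk; rewrite mem_head.
  by apply: Hk; rewrite inE Hin orbT.
Qed.

(** Each use of [StepCtx] descends along one subelement edge. This is how the hypotheses that
    nothing is forbidden below a type get applied to steps. *)
Lemma step_below T T' A : step S T T' -> conf T -> lbl T = El A ->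
  exists2 u, S u & leD D A (uat_el u).
Proof.
move=> st; elim: st A => {T T'}
  [A B k ks|A B k ks|A B B' k k' ks|A s s' ks|A k k' ks] => HS.
- by move=> _ _ A' _; rewrite lbl_mk => -[<-]; exists (UIns A B) => //; apply: rt_refl.
- by move=> _ A' _; rewrite lbl_mk => -[<-]; exists (UDel A B) => //; apply: rt_refl.
- by move=> _ _ _ A' _; rewrite lbl_mk => -[<-]; exists (URepl A B B') => //; apply: rt_refl.
- by move=> A' _; rewrite lbl_mk => -[<-]; exists (UReplS A) => //; apply: rt_refl.
move=> IH A' /conf_nd[HA Hw Hk]; rewrite lbl_mk => -[<-] {A'}.
have ck : conf k by apply: Hk; rewrite mem_head.
case E: (lbl k) => [B|]; last first.
  case: ck HS E => [s /step_leaf //|? ? _ _ _ _]; by rewrite lbl_mk.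
have [u Su le] := IH B ck E; exists u => //.
apply: rt_trans le; apply: rt_step; split=> //.
move: Hw; rewrite /= E; case: (Rg D A) => //=.
- move=> bs /perm_mem/(_ (El B)); rewrite inE eqxx /= => /esym/mapP[b ?].
  by case=> ->.
- by move=> bs [b b_in [-> _]].
- by move=> b /andP[/eqP[->] _]; rewrite inE.
Qed.

End Valid.
End Steps.

(** * Matchings between multisets of children *)

Section Matched.
Variables (T : eqType) (R : T -> T -> Prop).

Definition matched (s s' : seq T) : Prop := exists z : seq (T * T),
  [/\ perm_eq (unzip1 z) s, perm_eq (unzip2 z) s' & forall p, p \in z -> R p.1 p.2].

Lemma matched_size s s' : matched s s' -> size s = size s'.
Proof. by case=> z [/perm_size <- /perm_size <- _]; rewrite !size_map. Qed.

Lemma matched_refl s : (forall x, R x x) -> matched s s.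
Proof.
move=> R_refl; exists [seq (x, x) | x <- s]; split.
- by rewrite /unzip1 -map_comp map_id.
- by rewrite /unzip2 -map_comp map_id.
- by move=> p /mapP[x _ ->].
Qed.

Lemma matched_perm_r s s' s'' : perm_eq s'' s' -> matched s s' -> matched s s''.
Proof.
rewrite perm_sym => P [z [Z1 Z2 ZR]]; exists z; split=> //.
exact: perm_trans Z2 P.
Qed.

(** Only the pair that ends in [k] is changed; it is redirected to [k']. *)
Lemma matched_upd s s' s'' k k' ks : (forall x, R x k -> R x k') ->
  perm_eq s' (k :: ks) -> perm_eq s'' (k' :: ks) -> matched s s' -> matched s s''.
Proof.
move=> Rk P1 P2 [z [Z1 Z2 ZR]].
have: k \in unzip2 z by rewrite (perm_mem Z2) (perm_mem P1) mem_head.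
case/mapP=> -[x k0] Hin /= E; subst k0.
have Pz := perm_to_rem Hin; set z' := rem _ z in Pz.
exists ((x, k') :: z'); split=> /=.
- by apply: perm_trans Z1; rewrite perm_sym; apply: (perm_map (@fst _ _) Pz).
- rewrite perm_sym (perm_trans P2) // perm_cons -(perm_cons k).
  rewrite perm_sym; apply: perm_trans P1; apply: perm_trans Z2.
  by rewrite perm_sym; apply: (perm_map (@snd _ _) Pz).
- move=> p; rewrite inE => /predU1P[->|Hp] /=.
    by apply: Rk; apply: (ZR (x, k)).
  by apply: ZR; rewrite (perm_mem Pz) inE Hp orbT.
Qed.

(* The matching is a permutation of [k :: ks] fixing everything but [k], which
   it sends to [k']; composing R along the cycle through [k] relates k to k'. *)
Lemma matched_cycle k k' ks : (forall x y z, R x y -> R y z -> R x z) ->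
  matched (k :: ks) (k' :: ks) -> R k k'.
Proof.
move=> R_trans; have [n le_n] := ubnP (size ks).
elim: n => // n IH in k ks le_n *; case=> z [Z1 Z2 ZR].
have: k \in unzip1 z by rewrite (perm_mem Z1) mem_head.
case/mapP=> -[k0 y] Hin /= E; subst k0.
have Rky : R k y by apply: (ZR (k, y)).
have Pz := perm_to_rem Hin; set z' := rem _ z in Pz.
have [<- //|ne] := eqVneq y k'.
have Z1' : perm_eq (unzip1 z') ks.
  rewrite -(perm_cons k); apply: perm_trans Z1.
  by rewrite perm_sym; apply: (perm_map (@fst _ _) Pz).
have Z2' : perm_eq (y :: unzip2 z') (k' :: ks).
  by apply: perm_trans Z2; rewrite perm_sym; apply: (perm_map (@snd _ _) Pz).
have yks : y \in ks.
  by have := perm_mem Z2' y; rewrite mem_head inE (negPf ne) => /esym.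
(* Dropping the pair [(k, y)] shortens the cycle: the remaining pairs match [y :: ks0] with
   [k' :: ks0]. *)
have Pk := perm_to_rem yks; set ks0 := rem y ks in Pk.
apply: (R_trans _ y) => //; apply: (IH y ks0).
  by move: le_n; rewrite (perm_size Pk).
exists z'; split=> //.
- exact: perm_trans Z1' Pk.
- rewrite -(perm_cons y) (perm_trans Z2') // -[y :: k' :: _]/([:: y] ++ [:: k'] ++ ks0).
  by rewrite perm_sym perm_catCA /= perm_cons perm_sym.
- by move=> p Hp; apply: ZR; rewrite (perm_mem Pz) inE Hp orbT.
Qed.

End Matched.

(** * Sequences of allowed steps at a node *)

Section Star.

Variables (D : dtd) (S : uat -> Prop).
Hypothesis S_valid : forall u, S u -> valid_uat D u.

Definition steps := clos_refl_trans utree (step D S).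

Lemma steps_lbl T T' : steps T T' -> lbl T' = lbl T.
Proof. by elim=> [x y /step_lbl|//|x y z _ E1 _ ->]. Qed.

Lemma steps_conf T T' : steps T T' -> conf D T -> conf D T'.
Proof. by elim=> [x y /(step_conf S_valid)|//|x y z _ E1 _ E2 /E1]. Qed.

Lemma steps_leaf s T : steps (leaf s) T -> T = leaf s.
Proof.
move=> /(@clos_rt_rt1n _ _ _ _); move E: (leaf s) => U H.
by case: H E => // V W + _ E; rewrite -E => /step_leaf.
Qed.

(* The invariant of a sequence of steps at a node labelled [A]: an insertion can
   only be compensated by a deletion, and a replacement by a cycle. *)
Variant evolved A (ks ks' : seq utree) : Prop :=
| EvMatched of matched steps ks ks'
| EvStr of S (UReplS A)
| EvInsDel B of S (UIns A B) & S (UDel A B)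
| EvIns B of S (UIns A B) & size ks < size ks'
| EvDel B of S (UDel A B) & size ks' < size ks
| EvRepl k k' b b' of ks = [:: k] & ks' = [:: k'] & lbl k = El b & lbl k' = El b'
    & clos_trans nat (replace_edge D S A) b b'.

Lemma replace_edge_disj A b b' : clos_trans nat (replace_edge D S A) b b' ->
  exists bs, Rg D A = RDisj bs.
Proof. by elim=> [x y [[bs HR _] _]|//]; exists bs. Qed.

(** Validity of a UAT at [A] determines the form of [Rg D A], so insertions, replacements and string
    updates at the same node exclude each other. Under a star the number of children tells whether
    insertions or deletions have occurred; under a disjunction there is a single child, whose label
    moves along the replace graph. *)
Lemma evolved_step A ks ks' ks'' : conf D (nd A ks') ->
  kstep D S A ks' ks'' -> evolved A ks ks' -> evolved A ks ks''.
Proof.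
(* The cases [EvStr] and [EvInsDel] are absorbing and are closed here. *)
move=> /conf_nd[_ w' _] st ev; case: ev => [M|H|B Hi Hd|B Hi Hs|B Hd Hs|];
  last move=> k k' b b' Ek Ek' lk lk' HG; try by [exact: EvStr | exact: EvInsDel _ _ Hi Hd].
- have Es := matched_size M.
  case: st => [B k HI _ _ P|B k HD _ P|B B' k k' ks0 HR lk lk' P P'|HS|k k' ks0 st P P'].
  + by apply: (EvIns HI); rewrite (perm_size P) /= Es.
  + by apply: (EvDel HD); rewrite Es (perm_size P) /=.
  + have [_ [_ [bs HR' Hbs]]] := S_valid HR.
    move: w'; rewrite HR' => -[b0 _ /(congr1 size)]; rewrite size_map => s1.
    have ks00 : ks0 = [::] by apply: size0nil; move: s1; rewrite (perm_size P) => -[].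
    rewrite {}ks00 in P P'.
    move/perm_eq_seq1: P => E; move/perm_eq_seq1: P' => E'; subst ks' ks''.
    (* A matching onto a singleton is a single pair [(x, k)], and [x] has the label of [k] because
       steps preserve labels. *)
    case: M => z [Z1 Z2 ZR]; case: z Z1 Z2 ZR => [|[x y] [|? ?]] Z1 Z2 ZR;
      move/perm_size: (Z2) => //= _.
    move/perm_eq_seq1: Z2 => /= [E]; subst y.
    have Ex : ks = [:: x] by move: Z1; rewrite perm_sym => /perm_small_eq->.
    apply: (EvRepl Ex erefl (b := B) (b' := B')) => //; last first.
      by apply: t_step; split=> //; exists bs.
    by rewrite -lk (steps_lbl (ZR (x, k) (mem_head _ _))).
  + exact: EvStr.
  + apply: EvMatched; apply: matched_upd P P' M => x Hx.
    by apply: rt_trans Hx _; apply: rt_step.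
- case: st => [B' k HI _ _ P|B' k HD _ P|B1 B' k k' ks0 HR lk lk' P P'|HS|k k' ks0 st P P'].
  + by apply: (EvIns HI); rewrite (perm_size P) /= ltnW.
  + apply: (EvInsDel _ _ Hi); have [_ HR] := S_valid Hi; have [_] := S_valid HD.
    by rewrite HR => -[->].
  + by apply: (EvIns Hi); move: Hs; rewrite (perm_size P) (perm_size P').
  + exact: EvStr.
  + by apply: (EvIns Hi); move: Hs; rewrite (perm_size P) (perm_size P').
- case: st => [B' k HI _ _ P|B' k HD _ P|B1 B' k k' ks0 HR lk lk' P P'|HS|k k' ks0 st P P'].
  + apply: (EvInsDel _ _ HI); have [_ HR] := S_valid Hd; have [_] := S_valid HI.
    by rewrite HR => -[<-].
  + by apply: (EvDel HD); move: Hs; rewrite (perm_size P) => /ltnW.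
  + by apply: (EvDel Hd); move: Hs; rewrite (perm_size P) (perm_size P').
  + exact: EvStr.
  + by apply: (EvDel Hd); move: Hs; rewrite (perm_size P) (perm_size P').
- have [bs HR'] := replace_edge_disj HG.
  case: st => [B' k1 HI _ _ P|B' k1 HD _ P|B1 B' k1 k1' ks0 HR lk1 lk1' P P'|HS|k1 k1' ks0 st P P'].
  + by have [_] := S_valid HI; rewrite HR'.
  + by have [_] := S_valid HD; rewrite HR'.
  + move: P; rewrite Ek' perm_sym => /perm_eq_seq1[E1 E2]; subst k1 ks0.
    move/perm_eq_seq1: P' => E; subst ks''.
    apply: (EvRepl Ek erefl lk lk1'); apply: (t_trans _ _ _ _ _ HG).
    apply: t_step; move: lk1; rewrite lk' => -[->]; split=> //.
    by have [_ [_]] := S_valid HR.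
  + exact: EvStr.
  + move: P; rewrite Ek' perm_sym => /perm_eq_seq1[E1 E2]; subst k1 ks0.
    move/perm_eq_seq1: P' => E; subst ks''.
    by apply: (EvRepl Ek erefl lk _ HG); rewrite (step_lbl st).
Qed.

Lemma steps_evolved A ks Y : conf D (nd A ks) -> steps (nd A ks) Y ->
  exists2 ks', Y = nd A ks' & evolved A ks ks'.
Proof.
move=> c /(@clos_rt_rtn1 _ _ _ _); elim=> [|Z Y' st ZS [ks' EZ ev]].
  by exists ks => //; apply: EvMatched; apply: matched_refl => x; apply: rt_refl.
move: st; rewrite EZ => /step_nd[ks'' -> st]; exists ks'' => //.
apply: evolved_step st ev => //; rewrite -EZ.
by apply: steps_conf c; apply: clos_rtn1_rt.
Qed.

End Star.

(** * The three conditions imply consistency, on canonical forms *)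

Section Backward.

Variables (D : dtd) (Aset Fset : uat -> Prop).
Hypotheses (A_valid : forall u, Aset u -> valid_uat D u)
  (F_valid : forall u, Fset u -> valid_uat D u)
  (AF_disj : forall u, Aset u -> Fset u -> False).
Hypothesis insdel_ok : forall A B, A \in Ele D -> Rg D A = RStar B ->
  Aset (UIns A B) -> Aset (UDel A B) -> nothing_forbidden_below D Fset B.
Hypothesis repl_ok : forall A bs, A \in Ele D -> Rg D A = RDisj bs ->
  forall Bi Bj, clos_trans nat (replace_edge D Aset A) Bi Bj ->
  ~ Fset (URepl A Bi Bj).
Hypothesis cycle_ok : forall A bs, A \in Ele D -> Rg D A = RDisj bs ->
  forall Bi, Bi \in bs -> clos_trans nat (replace_edge D Aset A) Bi Bi ->
  nothing_forbidden_below D Fset Bi.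

(** Each case of the forbidden step is confronted with each case of [evolved]. When the forbidden
    UAT acts at the root, its validity fixes [Rg D A] and most cases clash with it; the induction
    hypothesis is needed for [StepCtx] alone. *)
Lemma no_forbidden_steps T T' : conf D T -> step D Fset T T' -> T <> T' ->
  ~ steps D Aset T T'.
Proof.
move=> + st; elim: st => {T T'}
  [A B k ks|A B k ks|A B B' k k' ks|A s s' ks|A k k' ks].
(* One child more excludes a matching or a loss of children; otherwise the forbidden insertion
   itself would be allowed. The deletion case is symmetric. *)
- move=> HF lk ck c _ /(steps_evolved A_valid c)[ks' /mk_inj[_ _ /perm_size E]].
  have [HA HR] := F_valid HF.
  case=> [/matched_size|/A_valid[_]|B0 HI _|B0 HI _|B0 _|k1 k2 b b' _ _ _ _ /replace_edge_disj[bs]];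
    rewrite ?HR //.
  + by rewrite -E => /n_Sn.
  + by have [_] := A_valid HI; rewrite HR => -[E0]; subst B0; apply: AF_disj HI HF.
  + by have [_] := A_valid HI; rewrite HR => -[E0]; subst B0; apply: AF_disj HI HF.
  + by rewrite -E ltnNge leqnSn.
- move=> HF lk c _ /(steps_evolved A_valid c)[ks' /mk_inj[_ _ /perm_size E]].
  have [HA HR] := F_valid HF.
  case=> [/matched_size|/A_valid[_]|B0 _ HI|B0 _|B0 HI _|k1 k2 b b' _ _ _ _ /replace_edge_disj[bs]];
    rewrite ?HR //.
  + by rewrite -E => /esym/n_Sn.
  + by have [_] := A_valid HI; rewrite HR => -[E0]; subst B0; apply: AF_disj HI HF.
  + by rewrite -E ltnNge leqnSn.
  + by have [_] := A_valid HI; rewrite HR => -[E0]; subst B0; apply: AF_disj HI HF.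
- move=> HF lk lk' ck c _ /(steps_evolved A_valid c)[ks' /mk_inj[_ _ P]].
  have [HA [ne [bs HR _]]] := F_valid HF.
  case=> [M|/A_valid[_]|B0 /A_valid[_]|B0 /A_valid[_]|B0 /A_valid[_]|k1 k2 b b' E1 E2 l1 l2 HG];
    rewrite ?HR //.
  (* The cycle gives steps from [k] to [k'], which is impossible since their labels differ. *)
  + move: M => /(matched_perm_r P)/matched_cycle st.
    have {st}/steps_lbl := st (@rt_trans _ _).
    by rewrite lk lk' => -[E]; move: ne; rewrite E eqxx.
  + case: E1 => Ek Eks; subst k1 ks; move: P; rewrite E2.
    move=> /perm_eq_seq1[E]; subst k2.
    move: l1 l2; rewrite lk lk' => -[E1] [E3]; subst b b'.
    exact: (repl_ok HA HR HG HF).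
- move=> HF c ne /(steps_evolved A_valid c)[ks' /mk_inj[_ _ P]].
  have [HA HR] := F_valid HF.
  case=> [M|H|B0 /A_valid[_]|B0 /A_valid[_]|B0 /A_valid[_]|k1 k2 b b' _ _ _ _ /replace_edge_disj[bs]];
    rewrite ?HR //.
  (* A string leaf admits no step, so the two values coincide and the forbidden step was trivial. *)
  + move: M => /(matched_perm_r P)/matched_cycle st.
    by have {st}/steps_leaf E := st (@rt_trans _ _); case: ne; rewrite E.
  + exact: (AF_disj H HF).
- move=> st IH c ne /(steps_evolved A_valid c)[ks' /mk_inj[_ _ P]].
  have [HA Hw Hk] := conf_nd c; have ck := Hk k (mem_head _ _).
  (* The forbidden step inside [k] exhibits a forbidden UAT below the label of [k]. *)
  have below b : lbl k = El b -> ~ nothing_forbidden_below D Fset b.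
    by move=> E H; have [u Fu /(H u Fu)] := step_below st ck E.
  case=> [M|H|B0 H H'|B0 _|B0 _|k1 k2 b b' E1 E2 l1 l2 HG].
  + move: M => /(matched_perm_r P)/matched_cycle st'; have {}st' := st' (@rt_trans _ _).
    by apply: IH st' => // E; apply: ne; rewrite E.
  + have [_ HR] := A_valid H; move: Hw; rewrite HR /= => -[lk _].
    by case: ck st lk => [s /step_leaf|? ? _ _ _ _] //; rewrite lbl_mk.
  + have [_ HR] := A_valid H; apply: (below B0).
      by move: Hw; rewrite HR => /= /andP[/eqP].
    exact: (insdel_ok HA HR H H').
  + by rewrite -(perm_size P) ltnn.
  + by rewrite -(perm_size P) ltnn.
  (* The step inside [k] preserves its label, so the path in the replace graph is a cycle and
     condition (3) applies. *)
  + case: E1 => Ek Eks; subst k1 ks; move: P; rewrite E2.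
    move=> /perm_eq_seq1[E]; subst k2.
    move: l2; rewrite (step_lbl st) l1 => -[E]; subst b'.
    have [bs HR] := replace_edge_disj HG.
    apply: (below b) => //; apply: (cycle_ok HA HR _ HG).
    by move: Hw; rewrite HR /= => -[b0 b0_in [E]]; move: E l1 => -> [<-].
Qed.

End Backward.

(** * Descendants in graph trees *)

Definition erel (t : tree) : rel nat := fun x y => (x, y) \in edges t.

Lemma ancP E k n x :
  reflect (exists p, [/\ path (fun a b => (a, b) \in E) n p, last n p = x & size p <= k])
          (anc E k n x).
Proof.
elim: k x => [|k IH] x /=.
  rewrite orbF; apply: (iffP eqP) => [->|[p [_ <-]]]; first by exists [::].
  by rewrite leqn0 size_eq0 => /eqP->.
apply: (iffP orP) => [[/eqP->|/hasP[[a b] Hab] /andP[/= /eqP Eb /IH[p [Hp Hl Hs]]]]|].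
- by exists [::].
- exists (rcons p x); rewrite rcons_path last_rcons size_rcons Hp Hl -Eb Hab; split=> //.
- case=> p; case/lastP: p => [|p y] []; first by move=> _ <-; left; rewrite eqxx.
  rewrite rcons_path last_rcons size_rcons => /andP[Hp Hy] Ey Hs; right.
  apply/hasP; exists (last n p, y) => //=; rewrite Ey eqxx /=.
  by apply/IH; exists p.
Qed.

(** The fuel [size (edges t)] loses nothing: a shortened path has distinct vertices, and all but the
    first are targets of edges. *)
Lemma descP t n x :
  reflect (exists2 p, path (erel t) n p & last n p = x) (desc t n x).
Proof.
apply: (iffP (ancP _ _ _ _)) => [[p [Hp Hl _]]|[p Hp <-]]; first by exists p.
case/shortenP: Hp => p' Hp' Hu _; exists p'; split=> //.
move: Hu => /= /andP[_ Hu].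
rewrite -(size_map (@snd nat nat) (edges t)).
apply: uniq_leq_size => // y Hy; case/splitPr: Hy Hp' => p1 p2.
rewrite cat_path /= => /andP[_ /andP[H _]].
by apply/mapP; exists (last n p1, y).
Qed.

Lemma desc_refl t x : desc t x x.
Proof. by apply/descP; exists [::]. Qed.

Lemma desc_edge t x y : erel t x y -> desc t x y.
Proof. by move=> H; apply/descP; exists [:: y] => //=; rewrite H. Qed.

Lemma desc_trans t : ssrbool.transitive (desc t).
Proof.
move=> y x z /descP[p Hp Hl] /descP[q Hq Hm]; apply/descP; exists (p ++ q).
  by rewrite cat_path Hp Hl.
by rewrite last_cat Hl.
Qed.

Lemma desc_ind t n (P : nat -> Prop) : P n ->
  (forall x y, desc t n x -> P x -> erel t x y -> P y) ->
  forall y, desc t n y -> P y.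
Proof.
move=> P0 PS y /descP[p Hp <-] {y}; elim/last_ind: p Hp => // p y IH.
rewrite rcons_path last_rcons => /andP[Hp Hy]; apply: PS Hy; last exact: IH.
by apply/descP; exists p.
Qed.

Lemma desc_top t n y : desc t n y -> n = y \/ exists2 c, erel t n c & desc t c y.
Proof.
case/descP=> -[|c p] /=; first by left.
by move=> /andP[Hc Hp] Hl; right; exists c => //; apply/descP; exists p.
Qed.

Lemma desc_bot t n y : desc t n y -> n = y \/ exists2 x, desc t n x & erel t x y.
Proof.
move=> H; elim/desc_ind: _ / H; first by left.
by move=> x z H _ Hz; right; exists x.
Qed.

Lemma desc_rt t x y : clos_refl_trans nat (edge_rel t) x y <-> desc t x y.
Proof.
split; first by elim=> [? ? /desc_edge|?|? ? ? _ + _]; [|exact: desc_refl|exact: desc_trans].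
move=> H; elim/desc_ind: _ / H => [|a b _ Hx Hb]; first exact: rt_refl.
by apply: rt_trans Hx _; apply: rt_step.
Qed.

(** The counts of incoming edges become the absence of a parent at the root and the uniqueness of
    parents. Existence of a parent elsewhere follows from reachability. *)
Record tree_spec (t : tree) : Prop := TreeSpec {
  ts_nodes : uniq (nodes t);
  ts_edges : uniq (edges t);
  ts_root : root t \in nodes t;
  ts_dom : forall x y, erel t x y -> (x \in nodes t) && (y \in nodes t);
  ts_orphan : forall x, ~~ erel t x (root t);
  ts_parent : forall p q x, erel t p x -> erel t q x -> p = q;
  ts_reach : forall x, x \in nodes t -> desc t (root t) x }.

Lemma is_treeP t : is_tree t <-> tree_spec t.
Proof.
have count0 y : (count (fun e => e.2 == y) (edges t) = 0) <-> (forall x, ~~ erel t x y).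
  split=> [/eqP|H].
    rewrite eqn0Ngt -has_count => /hasPn H x; apply/negP=> /H /=.
    by rewrite eqxx.
  apply/eqP; rewrite eqn0Ngt -has_count; apply/hasPn=> -[a b] Hab /=.
  by apply: contraNneq (H a) => <-.
split=> [[H1 [H2 [H3 [H4 [H5 [H6 H7]]]]]]|[H1 H2 H3 H4 H5 H6 H7]].
  split=> //.
  - by move=> x y /H4.
  - exact/count0.
  - move=> p q x Hp Hq; have /andP[_ /= Nx] := H4 _ Hp.
    have [E|ne] := eqVneq x (root t).
      by move/count0/(_ p): H5; rewrite -E Hp.
    move: (H6 _ Nx ne); rewrite -size_filter; set F := filter _ _ => Fs.
    have Hp' : (p, x) \in F by rewrite mem_filter eqxx.
    have Hq' : (q, x) \in F by rewrite mem_filter eqxx.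
    case: F Fs Hp' Hq' => [|e []] //= _; rewrite !inE => /eqP<- /eqP[->] //.
  - by move=> x /H7/desc_rt.
split=> //; split=> //; split=> //; split; first by case=> x y; exact: H4.
split; first exact/count0.
split; last by move=> x /H7/desc_rt.
move=> x Nx ne; have [E|[p _ Hp]] := desc_bot (H7 _ Nx).
  by rewrite E eqxx in ne.
rewrite -size_filter; suff /perm_size -> : perm_eq [seq e <- edges t | e.2 == x] [:: (p, x)] by [].
apply: uniq_perm; rewrite ?filter_uniq // => -[a b].
rewrite mem_filter inE /=; apply/andP/eqP => [[/eqP-> Ha]|[-> ->]]; last by rewrite eqxx.
by rewrite (H6 _ _ _ Ha Hp).
Qed.

Lemma mem_children t x c : (c \in children t x) = erel t x c.
Proof.
apply/mapP/idP => [[[a b]]|H]; last by exists (x, c) => //; rewrite mem_filter eqxx.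
by rewrite mem_filter => /andP[/= /eqP-> H ->].
Qed.

Lemma uniq_children t x : uniq (edges t) -> uniq (children t x).
Proof.
move=> U; rewrite map_inj_in_uniq ?filter_uniq // => -[a b] [c d].
by rewrite !mem_filter /= => /andP[/eqP-> _] /andP[/eqP-> _] ->.
Qed.

(** Provides one amount of fuel valid for all nodes, both for the depth bound in [tree_ind] and for
    the recursion in [labeling_ex]. *)
Lemma uniform_bound (s : seq nat) (Q : nat -> nat -> Prop) :
  (forall x, x \in s -> exists N, forall n, N <= n -> Q x n) ->
  exists N, forall x, x \in s -> forall n, N <= n -> Q x n.
Proof.
elim: s => [|a s IH] H; first by exists 0.
have [N HN] := IH (fun x Hx => H x (mem_behead (s := a :: s) Hx)).
have [M HM] := H a (mem_head _ _).
exists (maxn M N) => x; rewrite inE => /predU1P[->|Hx] n; rewrite geq_max => /andP[h1 h2].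
  exact: HM.
exact: HN.
Qed.

Section Tree.

Variable t : tree.
Hypothesis T : tree_spec t.

Lemma erel_l x y : erel t x y -> x \in nodes t.
Proof. by case/(ts_dom T)/andP. Qed.

Lemma erel_r x y : erel t x y -> y \in nodes t.
Proof. by case/(ts_dom T)/andP. Qed.

Lemma desc_nodes x y : x \in nodes t -> desc t x y -> y \in nodes t.
Proof. by move=> Nx H; elim/desc_ind: _ / H => // a b _ _ /erel_r. Qed.

Lemma parent_edge p x : erel t p x -> parent t x = p.
Proof.
move=> H; rewrite /parent.
have: (p, x) \in [seq e <- edges t | e.2 == x] by rewrite mem_filter eqxx.
case E: [seq _ <- _ | _] => [|[a b] s] // _ /=.
have: (a, b) \in [seq e <- edges t | e.2 == x] by rewrite E mem_head.
by rewrite mem_filter => /andP[/= /eqP-> Ha]; apply: (ts_parent T) Ha H.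
Qed.

(** The default of [head] makes the root its own parent, so iterating [parent] stays at the root
    once it is reached. *)
Lemma parent_root : parent t (root t) = root t.
Proof.
rewrite /parent; case E: [seq _ <- _ | _] => [|[a b] s] //.
have: (a, b) \in [seq e <- edges t | e.2 == root t] by rewrite E mem_head.
by rewrite mem_filter => /andP[/= /eqP-> Ha]; move: (ts_orphan T a); rewrite /erel Ha.
Qed.

(** Bottom-up induction. It is well founded because depths are bounded by some [N], the depth being
    read off the iterates of [parent]. *)
Lemma tree_ind (P : nat -> Prop) :
  (forall x, x \in nodes t -> (forall c, erel t x c -> P c) -> P x) ->
  forall x, x \in nodes t -> P x.
Proof.
move=> PS.
have [N HN] : exists N, forall x, x \in nodes t -> forall n, N <= n ->
    iter n (parent t) x = root t.
  apply: (uniform_bound (Q := fun x n => iter n (parent t) x = root t)) => x /(ts_reach T) H.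
  elim/desc_ind: _ / H => [|a b _ [N HN] Hab].
    by exists 0 => n _; elim: n => //= n ->; exact: parent_root.
  by exists N.+1 => -[//|n] Hn; rewrite iterSr (parent_edge Hab) HN.
(* The hypothesis says that [x] has depth at least [N.+1 - k]: impossible for [k = 0], void for
   [k = N.+1]. *)
have key k : k <= N.+1 ->
    forall x, x \in nodes t -> (forall j, j < N.+1 - k -> iter j (parent t) x <> root t) -> P x.
  elim: k => [|k IH] lek x Nx Hx.
    by case: (Hx N); rewrite ?subn0 ?HN.
  apply: PS => // c Hc; apply: IH; rewrite ?(erel_r Hc) // ?(ltnW lek) //.
  case=> [_ E|j Hj]; first by move: (ts_orphan T x); rewrite -E /= Hc.
  rewrite iterSr (parent_edge Hc); apply: Hx.
  by rewrite subSS; move: Hj; rewrite subSn.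
by move=> x Nx; apply: (key N.+1) => // j; rewrite subnn.
Qed.

(** A cycle through [x] and its child [c] also passes through a child of [c], which the bottom-up
    induction hypothesis at [c] excludes. *)
Lemma desc_irr x c : erel t x c -> ~~ desc t c x.
Proof.
move=> Hc; have Nx := erel_l Hc; move: x Nx c Hc.
apply: tree_ind => x Nx IH c Hc; apply/negP => H.
case: (desc_top H) => [E|[d Hd H']].
  by subst c; move: (IH _ Hc _ Hc); rewrite desc_refl.
by move: (IH _ Hc _ Hd); rewrite (desc_trans H' (desc_edge Hc)).
Qed.

(** Parents being unique, the ancestors of [z] form a chain. *)
Lemma desc_comp x y z : desc t x z -> desc t y z -> desc t x y || desc t y x.
Proof.
move=> H; elim/desc_ind: _ / H => [->|a b Hxa IH Hab]; first by rewrite orbT.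
case/desc_bot=> [->|[a' Ha' Hab']]; first by rewrite (desc_trans Hxa (desc_edge Hab)).
by rewrite (ts_parent T Hab Hab') in IH; apply: IH.
Qed.

Lemma siblings_disj p c d z : erel t p c -> erel t p d ->
  desc t c z -> desc t d z -> c = d.
Proof.
have aux c' d' : erel t p c' -> erel t p d' -> desc t c' d' -> c' = d'.
  move=> Hc Hd /desc_bot[//|[q Hq Hqd]].
  by move: (desc_irr Hc); rewrite (ts_parent T Hd Hqd) Hq.
move=> Hc Hd Hcz Hdz; case/orP: (desc_comp Hcz Hdz) => H; first exact: aux.
by apply/esym; apply: aux H.
Qed.

End Tree.

(** * Canonical forms of graph trees and local changes *)

Definition sv (t : tree) x : strval := if lab t x == Str then sval t x else 0.

(** A specification instead of a function, as recursion along edges is not structural. The use of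
    [sv] masks the values that [iso] ignores. *)
Definition labeling (t : tree) (f : nat -> utree) : Prop :=
  forall x, x \in nodes t -> f x = mk (lab t x) (sv t x) (map f (children t x)).

Lemma labeling_ex t : tree_spec t -> exists f, labeling t f.
Proof.
move=> T.
(* The value at fuel 0 is a placeholder; it no longer shows once the fuel exceeds the height of the
   subtree. *)
pose ab := fix ab k x : utree := if k is k'.+1 then
  mk (lab t x) (sv t x) (map (ab k') (children t x)) else leaf 0.
have [N HN] : exists N, forall x, x \in nodes t -> forall n, N <= n -> ab n.+1 x = ab n x.
  apply: (uniform_bound (Q := fun x n => ab n.+1 x = ab n x)).
  apply: (tree_ind T) => x Nx IH.
  have [c|N HN] := @uniform_bound (children t x) (fun x n => ab n.+1 x = ab n x).
    by rewrite mem_children; exact: IH.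
  exists N.+1 => -[//|n] Hn /=; congr mk; apply/eq_in_map => c Hc.
  exact: HN.
by exists (ab N) => x Nx; rewrite -HN.
Qed.

Definition agree t t2 y :=
  [/\ y \in nodes t2, lab t2 y = lab t y, sv t2 y = sv t y
    & perm_eq (children t2 y) (children t y)].

Lemma agree_trans t t1 t2 y : agree t t1 y -> agree t1 t2 y -> agree t t2 y.
Proof.
by move=> [? E1 E2 P] [? E1' E2' P']; split; rewrite ?E1' ?E2' //; apply: perm_trans P' P.
Qed.

(** Every atomic update is local at the node whose child list or string child it changes, so only
    the canonical form of [p] has to be computed by hand. *)
Definition local t t2 p := forall y, y \in nodes t -> ~~ desc t p y -> agree t t2 y.

Section Agree.
Variables (t t2 : tree) (f f2 : nat -> utree).
Hypotheses (T : tree_spec t) (L : labeling t f) (L2 : labeling t2 f2).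

Lemma agree_labeling x : x \in nodes t ->
  (forall y, desc t x y -> agree t t2 y) -> f2 x = f x.
Proof.
move: x; apply: (tree_ind T) => x Nx IH H.
have [N2 E1 E2 P] := H x (desc_refl _ _).
rewrite L // L2 // E1 E2; apply: mk_perm; apply: perm_trans (perm_map _ P) _.
rewrite (_ : map f2 _ = map f (children t x)) //.
apply/eq_in_map=> c; rewrite mem_children => Hc; apply: IH => // y Hy.
by apply: H; apply: desc_trans Hy; exact: desc_edge.
Qed.

Variable p : nat.
Hypothesis (loc : local t t2 p).

Lemma local_aside x : x \in nodes t -> ~~ desc t p x -> ~~ desc t x p -> f2 x = f x.
Proof.
move=> Nx H1 H2; apply: agree_labeling => // y Hy; apply: loc.
  exact: desc_nodes Hy.
by apply/negP=> Hp; move: (desc_comp T Hy Hp); rewrite (negPf H1) (negPf H2).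
Qed.

(** The siblings of [c] avoid the changed subtree and keep their forms, so the two forms of [x]
    differ in one child only. This is the shape of [StepCtx]. *)
Lemma local_above x c : erel t x c -> desc t c p ->
  exists rest, [/\ perm_eq (children t x) (c :: rest),
    f x = mk (lab t x) (sv t x) (f c :: map f rest) &
    f2 x = mk (lab t x) (sv t x) (f2 c :: map f rest)].
Proof.
move=> Hc Hp; have Nx := erel_l T Hc.
have Cc : c \in children t x by rewrite mem_children.
have P := perm_to_rem Cc; set rest := rem c _ in P; exists rest; split=> //.
  by rewrite L //; apply: mk_perm; apply: (perm_map _ P).
have nx : ~~ desc t p x.
  by apply/negP => H; move: (desc_irr T Hc); rewrite (desc_trans Hp H).
have [N2 E1 E2 P2] := loc Nx nx.
rewrite L2 // E1 E2; apply: mk_perm.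
apply: perm_trans (perm_map _ (perm_trans P2 P)) _ => /=; rewrite perm_cons.
rewrite (_ : map f2 _ = map f rest) //; apply/eq_in_map=> d Hd.
have [dc Hxd] : d != c /\ erel t x d.
  move: Hd; rewrite mem_rem_uniq ?uniq_children ?(ts_edges T) //.
  by rewrite inE mem_children => /andP[].
apply: local_aside; first exact: erel_r Hxd.
  apply/negP=> H; move: dc; rewrite -(siblings_disj T Hc Hxd (z := d)) ?eqxx ?desc_refl //.
  exact: desc_trans Hp H.
by apply/negP=> H; move: dc; rewrite -(siblings_disj T Hc Hxd Hp H) eqxx.
Qed.

End Agree.

(** * Effect of the updates on canonical forms *)

Lemma childrenE t x : (forall y, ~~ erel t x y) -> children t x = [::].
Proof.
move=> H; case E: (children t x) => [//|c s].
by move: (H c); rewrite -mem_children E mem_head.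
Qed.

Lemma desc_sub t t2 x y : (forall a b, erel t a b -> erel t2 a b) ->
  desc t x y -> desc t2 x y.
Proof.
move=> sub H; elim/desc_ind: _ / H => [|a b _ H /sub/desc_edge]; first exact: desc_refl.
exact: desc_trans.
Qed.

Section Insert.

Variables (t t' : tree) (n : nat).
Hypotheses (T : tree_spec t) (T' : tree_spec t').
Hypotheses (Nn : n \in nodes t) (dis : disjoint_from t' t).

Let t2 := do_insert t n t'.

Lemma insert_disj x : x \in nodes t -> x \in nodes t' -> False.
Proof. by move=> Nx /(allP dis); rewrite Nx. Qed.

Lemma insert_erel x y :
  erel t2 x y = [|| erel t x y, erel t' x y | (x == n) && (y == root t')].
Proof. by rewrite /erel /= !mem_cat inE. Qed.

Lemma insert_children x :
  children t2 x = children t x ++ children t' x ++ (if n == x then [:: root t'] else [::]).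
Proof. by rewrite /children /= !filter_cat !map_cat /=; case: eqP. Qed.

Lemma insert_tree : tree_spec t2.
Proof.
have Er' := ts_root T'.
have tt' x y : erel t x y -> erel t' x y -> False.
  by move=> /(erel_l T) H /(erel_l T'); apply: insert_disj.
split=> /=.
- rewrite cat_uniq (ts_nodes T) (ts_nodes T') andbT /=; apply/hasPn => x Hx.
  exact: (allP dis).
- rewrite !cat_uniq (ts_edges T) (ts_edges T') /= !andbT orbF.
  apply/andP; split.
    apply/hasPn=> -[x y]; rewrite mem_cat inE => /orP[H|/eqP[-> ->]]; apply/negP => H'.
      exact: (tt' x y).
    by apply: (insert_disj (x := root t')) => //; apply: erel_r H'.
  by apply/negP=> /(erel_l T') /(insert_disj Nn).
- by rewrite mem_cat (ts_root T).
- move=> x y; rewrite insert_erel !mem_cat => /or3P[/(ts_dom T)|/(ts_dom T')|].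
  + by case/andP=> -> ->.
  + by case/andP=> -> ->; rewrite !orbT.
  + by case/andP=> /eqP-> /eqP->; rewrite Nn Er' orbT.
- move=> x; rewrite insert_erel (negPf (ts_orphan T x)) /=; apply/negP=> /orP[].
    by move=> /(erel_r T') /(insert_disj (ts_root T)).
  by case/andP=> _ /eqP E; apply: (insert_disj (ts_root T)); rewrite E.
- move=> p q x; rewrite !insert_erel.
  move=> /or3P[Hp|Hp|/andP[/eqP-> /eqP Ep]] /or3P[Hq|Hq|/andP[/eqP-> /eqP Eq]] //.
  + exact: (ts_parent T Hp Hq).
  + by case: (insert_disj (erel_r T Hp) (erel_r T' Hq)).
  + by case: (insert_disj (erel_r T Hp)); rewrite Eq.
  + by case: (insert_disj (erel_r T Hq) (erel_r T' Hp)).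
  + exact: (ts_parent T' Hp Hq).
  + by move: (ts_orphan T' p); rewrite -Eq Hp.
  + by case: (insert_disj (erel_r T Hq)); rewrite Ep.
  + by move: (ts_orphan T' q); rewrite -Ep Hq.
- have sub x y : desc t x y -> desc t2 x y.
    by apply: desc_sub => a b; rewrite insert_erel => ->.
  have sub' x y : desc t' x y -> desc t2 x y.
    by apply: desc_sub => a b; rewrite insert_erel => ->; rewrite orbT.
  move=> x; rewrite mem_cat => /orP[/(ts_reach T)/sub //|/(ts_reach T')/sub'].
  apply: desc_trans; apply: (desc_trans (sub _ _ (ts_reach T Nn))).
  by apply: desc_edge; rewrite insert_erel !eqxx !orbT.
Qed.

Lemma insert_children_l x : x \in nodes t ->
  children t2 x = children t x ++ (if n == x then [:: root t'] else [::]).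
Proof.
move=> Nx; rewrite insert_children (@childrenE t') // => y.
by apply/negP => /(erel_l T'); apply: insert_disj.
Qed.

Lemma insert_lab x : x \in nodes t -> lab t2 x = lab t x /\ sv t2 x = sv t x.
Proof.
move=> Nx; have Nx' : (x \in nodes t') = false by apply/negP => /(insert_disj Nx).
by rewrite /sv /= Nx'.
Qed.

Lemma insert_agree_l y : y \in nodes t -> y != n -> agree t t2 y.
Proof.
move=> Ny ne; have [E1 E2] := insert_lab Ny; split=> //=.
  by rewrite mem_cat Ny.
by rewrite insert_children_l // eq_sym (negPf ne) cats0.
Qed.

Lemma insert_agree_r y : y \in nodes t' -> agree t' t2 y.
Proof.
move=> Ny; split; rewrite /sv /= ?Ny // ?mem_cat ?Ny ?orbT //.
rewrite insert_children (@childrenE t) /=; last first.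
  by move=> z; apply/negP => /(erel_l T) H; apply: insert_disj Ny.
case: eqP => [E|_]; last by rewrite cats0.
by case: (insert_disj Nn); rewrite E.
Qed.

Lemma insert_local : local t t2 n.
Proof.
move=> y Ny H; apply: insert_agree_l => //.
by apply: contraNneq H => ->; exact: desc_refl.
Qed.

Variables (f f' f2 : nat -> utree).
Hypotheses (L : labeling t f) (L' : labeling t' f') (L2 : labeling t2 f2).

Lemma insert_root_lbl : f2 (root t') = f' (root t').
Proof.
apply: (agree_labeling T' L' L2) (ts_root T') _ => y Hy; apply: insert_agree_r.
exact: (desc_nodes T' (ts_root T') Hy).
Qed.

Lemma insert_at : f2 n = mk (lab t n) (sv t n) (f' (root t') :: map f (children t n)).
Proof.
have [E1 E2] := insert_lab Nn.
rewrite L2 ?mem_cat ?Nn // E1 E2; apply: mk_perm.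
rewrite insert_children_l // eqxx cats1 map_rcons perm_rcons insert_root_lbl perm_cons.
rewrite (_ : map f2 _ = map f (children t n)) //; apply/eq_in_map => c.
rewrite mem_children => Hc; apply: (agree_labeling T L L2) (erel_r T Hc) _ => y Hy.
apply: insert_agree_l; first exact: (desc_nodes T (erel_r T Hc) Hy).
by apply: contraNneq (desc_irr T Hc) => <-.
Qed.

End Insert.

Section Delete.

Variables (t : tree) (p n : nat).
Hypotheses (T : tree_spec t) (Hpn : erel t p n).

Let t1 := do_delete t n.

Lemma delete_erel x y : erel t1 x y = [&& erel t x y, ~~ desc t n x & ~~ desc t n y].
Proof. by rewrite /erel /= mem_filter /= andbC. Qed.

Lemma delete_nodes x : (x \in nodes t1) = (x \in nodes t) && ~~ desc t n x.
Proof. by rewrite /= mem_filter andbC. Qed.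

Lemma delete_up x y : erel t x y -> ~~ desc t n y -> ~~ desc t n x.
Proof. by move=> Hxy; apply: contra => /desc_trans; apply; apply: desc_edge. Qed.

(** The only edge from a kept node to a deleted one is [(p, n)]. *)
Lemma delete_down x y : erel t x y -> x != p -> ~~ desc t n x -> ~~ desc t n y.
Proof.
move=> Hxy xp; apply: contra => /desc_bot[E|[q Hq Hqy]].
  by subst y; rewrite (ts_parent T Hxy Hpn) eqxx in xp.
by rewrite (ts_parent T Hxy Hqy).
Qed.

Lemma delete_p : ~~ desc t n p.
Proof. exact: (desc_irr T Hpn). Qed.

Lemma delete_p_in : p \in nodes t1.
Proof. by rewrite delete_nodes (erel_l T Hpn) delete_p. Qed.

Lemma delete_tree : tree_spec t1.
Proof.
have reach x : desc t (root t) x -> ~~ desc t n x -> desc t1 (root t) x.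
  move=> H; elim/desc_ind: _ / H => [_|a b _ IH Hab Hb]; first exact: desc_refl.
  have Ha := delete_up Hab Hb; apply: desc_trans (IH Ha) _; apply: desc_edge.
  by rewrite delete_erel Hab Ha Hb.
split.
- exact: (filter_uniq _ (ts_nodes T)).
- exact: (filter_uniq _ (ts_edges T)).
- rewrite delete_nodes (ts_root T) /=; apply/negP=> H.
  by move: delete_p; rewrite (desc_trans H) //; apply: (ts_reach T (erel_l T Hpn)).
- move=> x y; rewrite delete_erel !delete_nodes => /and3P[/(ts_dom T)/andP[-> ->] -> ->] //.
- by move=> x; rewrite delete_erel (negPf (ts_orphan T x)).
- by move=> a b x; rewrite !delete_erel => /and3P[Ha _ _] /and3P[Hb _ _]; apply: (ts_parent T Ha Hb).
- by move=> x; rewrite delete_nodes => /andP[/(ts_reach T)/reach].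
Qed.

Lemma delete_mem_children x : ~~ desc t n x ->
  children t1 x =i [seq c <- children t x | ~~ desc t n c].
Proof.
by move=> Hx c; rewrite mem_filter !mem_children delete_erel Hx andbC.
Qed.

Lemma delete_agree y : y \in nodes t -> ~~ desc t n y -> y != p -> agree t t1 y.
Proof.
move=> Ny Hy yp; split=> //; first by rewrite delete_nodes Ny.
apply: uniq_perm; rewrite ?uniq_children ?(ts_edges T) ?(ts_edges delete_tree) // => c.
rewrite delete_mem_children // mem_filter mem_children.
by case H: (erel t y c); rewrite ?andbF // (delete_down H).
Qed.

Lemma delete_children : perm_eq (children t p) (n :: children t1 p).
Proof.
have Hd := delete_p.
apply: uniq_perm; rewrite /= ?uniq_children ?(ts_edges T) ?(ts_edges delete_tree) //.
  by rewrite andbT delete_mem_children // mem_filter desc_refl.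
move=> c; rewrite inE delete_mem_children // mem_filter mem_children.
have [->|ne] := eqVneq c n; first by rewrite Hpn.
case H: (erel t p c) => /=; rewrite ?andbF // andbT.
apply/esym/negP=> Hc; move: ne.
by rewrite (siblings_disj T H Hpn (desc_refl _ _) Hc) eqxx.
Qed.

Lemma delete_sibling c y : c \in children t1 p -> desc t c y ->
  [/\ y \in nodes t, ~~ desc t n y & y != p].
Proof.
rewrite mem_children delete_erel => /and3P[Hc _ Hn] Hy; split.
- exact: (desc_nodes T (erel_r T Hc) Hy).
- apply/negP=> H; move: Hn.
  by rewrite -(siblings_disj T Hc Hpn Hy H) desc_refl.
- by apply: contraNneq (desc_irr T Hc) => <-.
Qed.

Lemma not_below_delete y : ~~ desc t p y -> ~~ desc t n y /\ y != p.
Proof.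
move=> H; split; last by apply: contraNneq H => ->; exact: desc_refl.
by apply: contra H => /(desc_trans (desc_edge Hpn)).
Qed.

Lemma delete_local : local t t1 p.
Proof. by move=> y Ny /not_below_delete[Hy yp]; apply: delete_agree. Qed.

Variable f : nat -> utree.
Hypothesis L : labeling t f.

(** Phrased with the children that remain after the deletion, so that this form and that of
    [delete_at] differ by the head [f n] alone. *)
Lemma delete_before :
  f p = mk (lab t p) (sv t p) (f n :: map f (children t1 p)).
Proof.
rewrite L ?(erel_l T Hpn) //; apply: mk_perm; exact: (perm_map f delete_children).
Qed.

Lemma delete_at f1 : labeling t1 f1 ->
  f1 p = mk (lab t p) (sv t p) (map f (children t1 p)).
Proof.
move=> L1; rewrite L1 ?delete_p_in //; congr mk; apply/eq_in_map => c Hc.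
apply: (agree_labeling T L L1); first by have [] := delete_sibling Hc (desc_refl _ _).
by move=> y /(delete_sibling Hc)[*]; exact: delete_agree.
Qed.

Variable t' : tree.
Hypotheses (T' : tree_spec t') (dis : disjoint_from t' t).
Let t2 := do_insert t1 p t'.

Lemma replace_disj : disjoint_from t' t1.
Proof. by apply/allP=> x /(allP dis); apply: contra; rewrite delete_nodes => /andP[]. Qed.

Lemma replace_tree : tree_spec t2.
Proof. exact: (insert_tree delete_tree T' delete_p_in replace_disj). Qed.

Lemma replace_agree y : y \in nodes t -> ~~ desc t n y -> y != p -> agree t t2 y.
Proof.
move=> Ny Hy yp; apply: (agree_trans (delete_agree Ny Hy yp)).
by apply: (insert_agree_l T' replace_disj) => //; rewrite delete_nodes Ny.
Qed.

Lemma replace_local : local t t2 p.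
Proof. by move=> y Ny /not_below_delete[Hy yp]; apply: replace_agree. Qed.

(** Deletion and insertion are composed. The intermediate tree need not conform, but canonical forms
    do not depend on conformance. *)
Lemma replace_at f' f2 : labeling t' f' -> labeling t2 f2 ->
  f2 p = mk (lab t p) (sv t p) (f' (root t') :: map f (children t1 p)).
Proof.
move=> L' L2; have [f1 L1] := labeling_ex delete_tree.
rewrite (insert_at delete_tree T' delete_p_in replace_disj L1 L' L2).
congr mk; congr (_ :: _); apply/eq_in_map=> c Hc.
apply: (agree_labeling T L L1); first by have [] := delete_sibling Hc (desc_refl _ _).
by move=> y /(delete_sibling Hc)[*]; exact: delete_agree.
Qed.

End Delete.

Section SetString.

Variables (t : tree) (p n : nat) (s : strval).
Hypotheses (T : tree_spec t) (Hpn : erel t p n).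

Let t2 := apply (ReplS n s) t.

Lemma setstr_tree : tree_spec t2.
Proof. by case: T => *; split. Qed.

Lemma setstr_agree y : y \in nodes t -> y != n -> agree t t2 y.
Proof. by move=> Ny ne; split=> //; rewrite /sv /= (negPf ne). Qed.

Lemma setstr_local : local t t2 p.
Proof.
move=> y Ny H; apply: setstr_agree => //.
by apply: contraNneq H => ->; exact: desc_edge.
Qed.

Variables (f f2 : nat -> utree).
Hypotheses (L : labeling t f) (L2 : labeling t2 f2).

Lemma setstr_at : f2 p = mk (lab t p) (sv t p) (f2 n :: map f (rem n (children t p))).
Proof.
have pn : p != n by apply: contraTneq (desc_irr T Hpn) => ->; rewrite desc_refl.
have [Np E1 E2 _] := setstr_agree (erel_l T Hpn) pn.
rewrite L2 // E1 E2; apply: mk_perm.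
have Cn : n \in children t2 p by rewrite mem_children.
apply: perm_trans (perm_map _ (perm_to_rem Cn)) _; rewrite /= perm_cons.
rewrite -[children t2 p]/(children t p) (_ : map f2 _ = map f (rem n (children t p))) //.
apply/eq_in_map=> c; rewrite mem_rem_uniq ?uniq_children ?(ts_edges T) //.
rewrite inE mem_children => /andP[/= cn Hc].
apply: (agree_labeling T L L2) (erel_r T Hc) _ => y Hy.
apply: setstr_agree; first exact: (desc_nodes T (erel_r T Hc) Hy).
apply: contra_neq cn => E; apply: (siblings_disj T Hc Hpn Hy).
by rewrite E desc_refl.
Qed.

Lemma setstr_before : f p = mk (lab t p) (sv t p) (f n :: map f (rem n (children t p))).
Proof.
rewrite L ?(erel_l T Hpn) //; apply: mk_perm.
have Cn : n \in children t p by rewrite mem_children.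
exact: (perm_map _ (perm_to_rem Cn)).
Qed.

Lemma setstr_leaf : lab t n = Str -> children t n = [::] -> f2 n = leaf s.
Proof.
move=> lS c0; rewrite L2 ?(erel_r T Hpn) // -[children t2 n]/(children t n) c0.
by rewrite /sv /= lS /= eqxx.
Qed.

End SetString.

(** * Isomorphism, conformance and simulation *)

Lemma uniq_map_inj (T U : eqType) (h : T -> U) (s : seq T) :
  uniq (map h s) -> {in s &, injective h}.
Proof.
elim: s => //= a s IH /andP[na us] x y; rewrite !inE.
case/predU1P=> [->|xs] /predU1P[->|ys] // E.
- by move: na; rewrite E map_f.
- by move: na; rewrite -E map_f.
- exact: IH.
Qed.

Lemma perm_map_matched (U : eqType) (f g : nat -> U) s s' :
  perm_eq (map f s) (map g s') -> matched (fun c d => f c = g d) s s'.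
Proof.
elim: s s' => [|c s IH] s' P.
  by case: s' P => [_|d s' /perm_size//]; exists [::].
have: f c \in map g s' by rewrite -(perm_mem P) mem_head.
case/mapP=> d ds' E; have P' := perm_to_rem ds'.
have [|z [Z1 Z2 ZR]] := IH (rem d s').
  rewrite -(perm_cons (f c)); apply: perm_trans P _; rewrite E.
  exact: (perm_map g P').
exists ((c, d) :: z); split=> /=.
- by rewrite perm_cons.
- by rewrite perm_sym (perm_trans P') // perm_cons perm_sym.
- by move=> q; rewrite inE => /predU1P[->|/ZR].
Qed.

Section Iso.

Variables (t1 t2 : tree) (f1 f2 : nat -> utree).
Hypotheses (T1 : tree_spec t1) (T2 : tree_spec t2).
Hypotheses (L1 : labeling t1 f1) (L2 : labeling t2 f2).

Lemma iso_shape : iso t1 t2 -> f1 (root t1) = f2 (root t2).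
Proof.
case=> g [gN [gS [gI [gR [gE [gL gV]]]]]]; rewrite -gR.
move: (root t1) (ts_root T1); apply: (tree_ind T1) => x Nx IH.
rewrite L1 // L2 ?gN // gL //.
have -> : sv t2 (g x) = sv t1 x by rewrite /sv gL //; case: eqP => // /(gV _ Nx).
apply: mk_perm; have -> : map f1 (children t1 x) = map f2 (map g (children t1 x)).
  by rewrite -map_comp; apply/eq_in_map => c; rewrite mem_children => /IH.
apply: perm_map; apply: uniq_perm.
- rewrite map_inj_in_uniq ?uniq_children ?(ts_edges T1) // => a b.
  by rewrite !mem_children => /(erel_r T1) Na /(erel_r T1) Nb; apply: gI.
- exact: uniq_children (ts_edges T2).
move=> d; rewrite mem_children; apply/mapP/idP => [[c]|Hd].
  rewrite mem_children => Hc ->; rewrite /erel -gE //; exact: erel_r Hc.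
have [c Nc Ec] := gS _ (erel_r T2 Hd); exists c => //.
by rewrite mem_children /erel gE // Ec.
Qed.

(** The function is constrained on the subtree of [x] only, which leaves room for gluing along
    disjoint subtrees. *)
Record sub_iso (x y : nat) (g : nat -> nat) : Prop := SubIso {
  si_map : forall a, desc t1 x a -> desc t2 y (g a);
  si_surj : forall w, desc t2 y w -> exists2 a, desc t1 x a & g a = w;
  si_inj : forall a b, desc t1 x a -> desc t1 x b -> g a = g b -> a = b;
  si_root : g x = y;
  si_edge : forall a b, desc t1 x a -> desc t1 x b -> erel t1 a b = erel t2 (g a) (g b);
  si_lab : forall a, desc t1 x a -> lab t2 (g a) = lab t1 a;
  si_sv : forall a, desc t1 x a -> sv t2 (g a) = sv t1 a }.

Lemma sub_iso_ext x y g h : (forall a, desc t1 x a -> h a = g a) ->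
  sub_iso x y g -> sub_iso x y h.
Proof.
move=> E [H1 H2 H3 H4 H5 H6 H7]; split.
- by move=> a Ha; rewrite E ?H1.
- by move=> w /H2[a Ha <-]; exists a; rewrite ?E.
- by move=> a b Ha Hb; rewrite !E //; apply: H3.
- by rewrite E ?desc_refl.
- by move=> a b Ha Hb; rewrite !E //; apply: H5.
- by move=> a Ha; rewrite E ?H6.
- by move=> a Ha; rewrite E ?H7.
Qed.

Lemma sub_iso_glue (z : seq (nat * nat)) :
  (forall q, q \in z -> exists g, sub_iso q.1 q.2 g) ->
  (forall q q' a, q \in z -> q' \in z -> desc t1 q.1 a -> desc t1 q'.1 a -> q = q') ->
  exists G, forall q, q \in z -> sub_iso q.1 q.2 G.
Proof.
elim: z => [|p z IH] H disj; first by exists id.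
have sub q : q \in z -> q \in p :: z by rewrite inE orbC => ->.
have [G' HG'] : exists G, forall q, q \in z -> sub_iso q.1 q.2 G.
  by apply: IH => [q /sub/H //|q q' a /sub Hq /sub Hq']; apply: disj.
have [g Hg] := H p (mem_head _ _).
exists (fun a => if desc t1 p.1 a then g a else G' a) => q Hq.
have [->|ne] := eqVneq q p; first by apply: sub_iso_ext Hg => a ->.
have Hqz : q \in z by move: Hq; rewrite inE (negPf ne).
apply: sub_iso_ext (HG' q Hqz) => a Ha; case: ifP => // Hpa.
by move: ne; rewrite (disj q p a) ?eqxx ?mem_head.
Qed.

(** Equal canonical forms give a pairing [z] of the children with equal forms. The isomorphisms
    obtained for the pairs are glued, and [x] is sent to [y]. *)
Lemma sub_iso_ex x : x \in nodes t1 -> forall y, y \in nodes t2 -> f1 x = f2 y ->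
  exists g, sub_iso x y g.
Proof.
move: x; apply: (tree_ind T1) => x Nx IH y Ny.
rewrite L1 // L2 // => /mk_inj[El Es /perm_map_matched[z [Z1 Z2 ZR]]].
have e1 q : q \in z -> erel t1 x q.1.
  by move=> Hq; rewrite -mem_children -(perm_mem Z1) map_f.
have e2 q : q \in z -> erel t2 y q.2.
  by move=> Hq; rewrite -mem_children -(perm_mem Z2) map_f.
have below1 a : desc t1 x a -> a = x \/ exists2 q, q \in z & desc t1 q.1 a.
  case/desc_top=> [->|[c]]; first by left.
  rewrite -mem_children -(perm_mem Z1) => /mapP[q Hq ->] Ha; right.
  by exists q.
have below2 w : desc t2 y w -> w = y \/ exists2 q, q \in z & desc t2 q.2 w.
  case/desc_top=> [->|[c]]; first by left.
  rewrite -mem_children -(perm_mem Z2) => /mapP[q Hq ->] Ha; right.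
  by exists q.
have ne1 q a : q \in z -> desc t1 q.1 a -> (a == x) = false.
  by move=> /e1 Hq Ha; apply: contraTF Ha => /eqP->; exact: (desc_irr T1 Hq).
have ne2 q w : q \in z -> desc t2 q.2 w -> w <> y.
  by move=> /e2 Hq Ha E; move: (desc_irr T2 Hq); rewrite -E Ha.
have disj1 q q' a : q \in z -> q' \in z -> desc t1 q.1 a -> desc t1 q'.1 a -> q = q'.
  move=> Hq Hq' Ha Ha'; apply: (uniq_map_inj (h := fst) _ Hq Hq').
    by rewrite (perm_uniq Z1) uniq_children ?(ts_edges T1).
  exact: (siblings_disj T1 (e1 _ Hq) (e1 _ Hq') Ha Ha').
have disj2 q q' w : q \in z -> q' \in z -> desc t2 q.2 w -> desc t2 q'.2 w -> q = q'.
  move=> Hq Hq' Ha Ha'; apply: (uniq_map_inj (h := snd) _ Hq Hq').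
    by rewrite (perm_uniq Z2) uniq_children ?(ts_edges T2).
  exact: (siblings_disj T2 (e2 _ Hq) (e2 _ Hq') Ha Ha').
have [G HG] : exists G, forall q, q \in z -> sub_iso q.1 q.2 G.
  apply: sub_iso_glue => // q Hq; apply: (IH _ (e1 _ Hq)); last exact: ZR.
  exact: erel_r (e2 _ Hq).
exists (fun a => if a == x then y else G a); split.
- move=> a /below1[->|[q Hq Ha]]; first by rewrite eqxx desc_refl.
  rewrite (ne1 q) //; apply: desc_trans (desc_edge (e2 _ Hq)) _.
  exact: (si_map (HG q Hq)).
- move=> w /below2[->|[q Hq Hw]]; first by exists x; rewrite ?eqxx ?desc_refl.
  have [a Ha <-] := si_surj (HG q Hq) Hw; exists a; last by rewrite (ne1 q).
  exact: desc_trans (desc_edge (e1 _ Hq)) Ha.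
- move=> a b /below1[->|[q Hq Ha]] /below1[->|[q' Hq' Hb]] //; rewrite ?eqxx.
  + by rewrite (ne1 q' b) // => /esym/(ne2 _ _ Hq' (si_map (HG _ Hq') Hb)).
  + by rewrite (ne1 q a) // => /(ne2 _ _ Hq (si_map (HG _ Hq) Ha)).
  rewrite (ne1 q a) // (ne1 q' b) // => E.
  have E' : q = q'.
    apply: (disj2 q q' (G a)) => //; first exact: (si_map (HG _ Hq) Ha).
    by rewrite E; exact: (si_map (HG _ Hq') Hb).
  by subst q'; apply: (si_inj (HG _ Hq)) E.
- by rewrite eqxx.
(* An edge of the subtree leads from its root to a child or stays inside one child subtree; none
   returns to the root or crosses between siblings. *)
- have irr1 a : erel t1 a a = false by apply/negP=> /(desc_irr T1); rewrite desc_refl.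
  have irr2 a : erel t2 a a = false by apply/negP=> /(desc_irr T2); rewrite desc_refl.
  move=> a b /below1[->|[q Hq Ha]] /below1[->|[q' Hq' Hb]]; rewrite ?eqxx ?irr1 ?irr2 //.
  + have Hb2 := si_map (HG _ Hq') Hb.
    rewrite (ne1 q' b) //; apply/idP/idP => H.
      rewrite (siblings_disj T1 H (e1 _ Hq') (desc_refl _ _) Hb).
      by rewrite (si_root (HG _ Hq')) e2.
    rewrite (si_inj (HG _ Hq') Hb (desc_refl _ _)) ?e1 //.
    by rewrite (si_root (HG _ Hq')) (siblings_disj T2 H (e2 _ Hq') (desc_refl _ _) Hb2).
  + have Ha2 := si_map (HG _ Hq) Ha.
    rewrite (ne1 q a) //; apply/idP/idP => H.
      by move: (desc_irr T1 H); rewrite (desc_trans (desc_edge (e1 _ Hq)) Ha).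
    by move: (desc_irr T2 H); rewrite (desc_trans (desc_edge (e2 _ Hq)) Ha2).
  have Ha2 := si_map (HG _ Hq) Ha; have Hb2 := si_map (HG _ Hq') Hb.
  rewrite (ne1 q a) // (ne1 q' b) //; apply/idP/idP => H.
    have E : q = q' by apply: (disj1 q q' b) => //; exact: desc_trans Ha (desc_edge H).
    by subst q'; rewrite -(si_edge (HG _ Hq)).
  have E : q = q' by apply: (disj2 q q' (G b)) => //; exact: desc_trans Ha2 (desc_edge H).
  by subst q'; rewrite (si_edge (HG _ Hq)).
- move=> a /below1[->|[q Hq Ha]]; first by rewrite eqxx.
  by rewrite (ne1 q) // (si_lab (HG _ Hq)).
- move=> a /below1[->|[q Hq Ha]]; first by rewrite eqxx.
  by rewrite (ne1 q) // (si_sv (HG _ Hq)).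
Qed.

Lemma shape_iso : f1 (root t1) = f2 (root t2) -> iso t1 t2.
Proof.
move=> E; have [g [H1 H2 H3 H4 H5 H6 H7]] := sub_iso_ex (ts_root T1) (ts_root T2) E.
have R1 := ts_reach T1; exists g; split; [|split; [|split; [|split; [|split; [|split]]]]].
- by move=> x /R1/H1; apply: (desc_nodes T2 (ts_root T2)).
- move=> y /(ts_reach T2)/H2[x Hx <-]; exists x => //.
  exact: (desc_nodes T1 (ts_root T1) Hx).
- by move=> x y /R1 Hx /R1 Hy; apply: H3.
- by [].
- by move=> x y /R1 Hx /R1 Hy; apply: H5.
- by move=> x /R1/H6.
- move=> x /R1 Hx lS; have := H7 _ Hx; rewrite /sv H6 // lS eqxx //.
Qed.

End Iso.

Lemma iso_refl t : iso t t.
Proof. by exists id; do !split=> //; move=> y; exists y. Qed.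

(** * Conformance read on canonical forms *)

Section Conforms.

Variables (D : dtd) (t : tree) (f : nat -> utree).
Hypotheses (T : tree_spec t) (L : labeling t f).

Lemma lbl_labeling x : x \in nodes t -> lbl (f x) = lab t x.
Proof. by move=> Nx; rewrite L // lbl_mk. Qed.

Lemma map_lbl_children x : map lbl (map f (children t x)) = map (lab t) (children t x).
Proof.
rewrite -map_comp; apply/eq_in_map => c; rewrite mem_children => /(erel_r T).
exact: lbl_labeling.
Qed.

Lemma conf_mk l s ks : conf D (mk l s ks) ->
  l = Str /\ ks = [::] \/ exists A, l = El A /\ s = 0.
Proof.
move E: (mk l s ks) => U c; case: c E => [s' /mk_inj[-> _]|A ks' _ _ _ /mk_inj[-> -> _]].
  by left; split=> //; apply: perm_small_eq.
by right; exists A.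
Qed.

Lemma conf_child x c : erel t x c -> conf D (f x) -> conf D (f c).
Proof.
move=> Hc; rewrite L ?(erel_l T Hc) // => cf.
have fc : f c \in map f (children t x) by rewrite map_f // mem_children.
case: (conf_mk cf) => [[_ E]|[A [El Es]]]; first by rewrite E in fc.
by move: cf; rewrite El Es => /conf_nd[_ _]; apply.
Qed.

Lemma conf_desc x y : desc t x y -> conf D (f x) -> conf D (f y).
Proof. by move=> H c; elim/desc_ind: _ / H => // a b _ ca /conf_child; apply. Qed.

Lemma conformsP A : conforms D A t <-> lab t (root t) = El A /\ conf D (f (root t)).
Proof.
split=> [[_ [lr H]]|[lr c]].
  split=> //; move: (root t) (ts_root T) => x Nx {lr}.
  move: x Nx; apply: (tree_ind T) => x Nx IH; rewrite L // /sv.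
  have := H x Nx; case E: (lab t x) => [B|] /=; last by move=> ->; exact: ConfStr.
  case=> HB Hw; apply: ConfEl => //; first by rewrite map_lbl_children.
  by move=> k /mapP[c]; rewrite mem_children => /IH + ->.
split; first exact/is_treeP.
split=> // x Nx; have := conf_desc (ts_reach T Nx) c; rewrite L // /sv.
case: (lab t x) => [B|] /=.
  by case/conf_nd; rewrite map_lbl_children.
case/conf_mk=> [[_]|[? [//]]].
by case: (children t x).
Qed.

End Conforms.

(** * Realizing canonical forms by trees with fresh nodes *)

Section Single.
Variables (l : Lab) (s : strval) (r : nat).

Definition single_tree := {| nodes := [:: r]; edges := [::];
  lab := fun=> l; Defs.sval := fun=> s; Defs.root := r |}.

Lemma single_tree_spec : tree_spec single_tree.
Proof.
by split=> //=; rewrite ?mem_head // => x; rewrite inE => /eqP->; exact: desc_refl.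
Qed.
End Single.

(** The lower bound [m] on the node names makes disjointness from a given finite tree available on
    demand. *)
Definition realizes (m : nat) (U : utree) (t : tree) :=
  [/\ tree_spec t, (forall f, labeling t f -> f (root t) = U)
    & all (fun x => m < x) (nodes t)].

Lemma leq_bigmax_mem (s : seq nat) x : x \in s -> x <= \max_(y <- s) y.
Proof. by move=> xs; rewrite (big_rem x) //= leq_maxl. Qed.

(** Children are inserted one by one under a single node. The side condition is needed because [sv]
    is 0 outside string nodes. *)
Lemma realizes_mk l s ks : (l = Str \/ s = 0) ->
  (forall k, k \in ks -> forall m, exists t, realizes m k t) ->
  forall m, exists t, realizes m (mk l s ks) t.
Proof.
move=> ls + m; elim: ks => [|k ks IH] H.
  exists (single_tree l s m.+1); split=> /=; [exact: single_tree_spec| |by rewrite ltnSn].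
  move=> f ->; rewrite ?mem_head //= /sv /=; case: eqP => // ne.
  by case: ls => // ->.
have [k' Hk'|t [T Tf Tm]] := IH; first by apply: H; rewrite inE Hk' orbT.
(* The bound exceeds both [m] and every node used so far. *)
have [t' [T' Tf' Tm']] := H k (mem_head _ _) (m + \max_(y <- nodes t) y).
have dis : disjoint_from t' t.
  apply/allP=> x /(allP Tm') H1; apply/negP => /leq_bigmax_mem H2.
  by move: (leq_trans H1 (leq_trans H2 (leq_addl m _))); rewrite ltnn.
exists (do_insert t (root t) t'); split.
- exact: (insert_tree T T' (ts_root T) dis).
- move=> f2 L2; have [f L] := labeling_ex T; have [f' L'] := labeling_ex T'.
  rewrite /= (insert_at T T' (ts_root T) dis L L' L2) Tf' //.
  have := Tf _ L; rewrite L ?(ts_root T) // => /mk_inj[-> -> P].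
  by apply: mk_perm; rewrite perm_cons.
- rewrite /= all_cat Tm; apply: sub_all Tm' => x; apply: leq_ltn_trans.
  exact: leq_addr.
Qed.

Lemma conf_realizes D U : conf D U -> forall m, exists t, realizes m U t.
Proof.
elim=> [s|A ks _ _ _ IH]; apply: realizes_mk => //; [by left|by right].
Qed.

Lemma conf_fresh D B k t : conf D k -> lbl k = El B ->
  exists t', [/\ tree_spec t', conforms D B t', disjoint_from t' t
    & forall f', labeling t' f' -> f' (root t') = k].
Proof.
move=> ck lk; have [t' [T' Tf' Tm']] := conf_realizes ck (\max_(y <- nodes t) y).
exists t'; split=> //.
  have [f' L'] := labeling_ex T'; apply/(conformsP D T' L').
  by rewrite -(lbl_labeling L' (ts_root T')) (Tf' _ L').
apply/allP=> x /(allP Tm') H1; apply/negP => /leq_bigmax_mem H2.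
by move: (leq_trans H1 H2); rewrite ltnn.
Qed.

(** * Atomic updates simulate rewriting steps and conversely *)

Section Simulation.

Variables (D : dtd) (S : uat -> Prop).

Section Local.
Variables (t : tree) (f : nat -> utree).
Hypotheses (T : tree_spec t) (L : labeling t f).

(** A step at [p] climbs to the root by [StepCtx]; conformance ensures that every node above [p] is
    an element node with value 0. *)
Lemma local_step t2 f2 p : conf D (f (root t)) -> labeling t2 f2 ->
  local t t2 p -> p \in nodes t -> step D S (f p) (f2 p) ->
  step D S (f (root t)) (f2 (root t)).
Proof.
move=> c L2 loc Np st; move: (ts_reach T Np) c.
move: (root t) (ts_root T); apply: (tree_ind T) => x Nx IH /desc_top[-> //|[c Hc Hp]] cf.
have {IH} := IH c Hc Hp (conf_child T L Hc cf).
have [rest [_ E1 ->]] := local_above T L L2 loc Hc Hp.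
move: cf; rewrite E1 => /conf_mk[[]//|[A [-> ->]]].
exact: StepCtx.
Qed.

Lemma parent_labE n A : parent_lab t n A -> exists p,
  [/\ erel t p n, parent t n = p, lab t p = El A & sv t p = 0].
Proof.
case=> p Hp lp; exists p; split=> //; last by rewrite /sv lp.
exact: parent_edge.
Qed.

Lemma op_sound o : conf D (f (root t)) -> valid_op t o -> in_sem D S t o ->
  [/\ tree_spec (apply o t), root (apply o t) = root t
    & forall f2, labeling (apply o t) f2 -> step D S (f (root t)) (f2 (root t))].
Proof.
move=> c; case: o => [n t'|n|n t'|n s] /= V [u Su]; case: u Su => //.
- move=> A B Su [ln cf']; case: V => Nn dis.
  have T' : tree_spec t' by apply/is_treeP; case: cf'.
  split=> // [|f2 L2]; first exact: insert_tree.
  apply: (local_step c L2 (@insert_local _ _ n T' dis) Nn).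
  have [f' L'] := labeling_ex T'; move/(conformsP D T' L'): cf' => [lr cr].
  rewrite (insert_at T T' Nn dis L L' L2) L // /sv ln /=.
  by apply: StepIns Su _ cr; rewrite (lbl_labeling L') // (ts_root T').
- move=> A B Su [ln /parent_labE[p [Hpn _ lp sp]]].
  split=> // [|f2 L2]; first exact: (delete_tree T Hpn).
  apply: (local_step c L2 (delete_local T Hpn) (erel_l T Hpn)).
  rewrite (delete_at T Hpn L L2) (delete_before T Hpn L) lp sp.
  by apply: StepDel Su _; rewrite (lbl_labeling L).
- move=> A B B' Su [ln [/parent_labE[p [Hpn -> lp sp]] [cf' ne]]]; case: V => Nn dis.
  have T' : tree_spec t' by apply/is_treeP; case: cf'.
  split=> // [|f2 L2]; first exact: (replace_tree T Hpn T' dis).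
  apply: (local_step c L2 (replace_local T Hpn T' dis) (erel_l T Hpn)).
  have [f' L'] := labeling_ex T'; move/(conformsP D T' L'): cf' => [lr cr].
  rewrite (replace_at T Hpn L T' dis L' L2) (delete_before T Hpn L) lp sp.
  by apply: StepRepl Su _ _ cr; rewrite ?(lbl_labeling L) ?(lbl_labeling L') // (ts_root T').
- move=> A Su [ln /parent_labE[p [Hpn _ lp sp]]].
  split=> // [|f2 L2]; first exact: setstr_tree.
  apply: (local_step c L2 (setstr_local s Hpn) (erel_l T Hpn)).
  have := conf_desc T L (ts_reach T V) c; rewrite L // ln.
  case/conf_mk=> [[_]|[? [//]]]; case E: (children t n) => // _.
  rewrite (setstr_at T Hpn L L2) (setstr_before T Hpn L) (setstr_leaf T Hpn L2) //.
  rewrite lp sp (L V) ln E; exact: StepStr.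
Qed.

(** Stated at an arbitrary node [x] so that the induction can descend through [StepCtx]. The node
    [p] of the change is returned so that [local_above] can rebuild the form of [x]. *)
Lemma op_complete x Y : x \in nodes t -> step D S (f x) Y ->
  (forall u, S u -> valid_uat D u) ->
  exists o p, [/\ valid_op t o, in_sem D S t o, tree_spec (apply o t),
    root (apply o t) = root t & desc t x p] /\ local t (apply o t) p /\
    forall f2, labeling (apply o t) f2 -> f2 x = Y.
Proof.
move=> Nx st Sv; move E: (f x) st => X st.
have mkE y A ks : y \in nodes t -> f y = nd A ks ->
    [/\ lab t y = El A, sv t y = 0 & perm_eq (map f (children t y)) ks].
  by move=> Ny; rewrite L // => /mk_inj.
have kidE y A k ks : y \in nodes t -> f y = nd A (k :: ks) ->
    exists2 c, erel t y c & f c = k.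
  move=> Ny /(mkE _ _ _ Ny)[_ _ P].
  have: k \in map f (children t y) by rewrite (perm_mem P) mem_head.
  by case/mapP=> c; rewrite mem_children; exists c.
elim: st x Nx E => {X Y} [A B k ks|A B k ks|A B B' k k' ks|A s s' ks|A k k' ks].
- move=> Su lk ck x Nx E; have [lx sx P] := mkE _ _ _ Nx E.
  have [t' [T' cf' dis Tf']] := conf_fresh t ck lk.
  exists (Ins x t'), x; split; first split=> //.
  + by exists (UIns A B).
  + exact: insert_tree.
  + exact: desc_refl.
  split; first exact: insert_local.
  move=> f2 L2; have [f' L'] := labeling_ex T'.
  rewrite (insert_at T T' Nx dis L L' L2) Tf' // lx sx.
  by apply: mk_perm; rewrite perm_cons.
- move=> Su lk x Nx E; have [c Hc fc] := kidE _ _ _ _ Nx E.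
  have [lx sx _] := mkE _ _ _ Nx E; have Nc := erel_r T Hc.
  exists (Del c), x; split; first split=> //.
  + exists (UDel A B) => //; split; first by rewrite -(lbl_labeling L) // fc.
    by exists x.
  + exact: (delete_tree T Hc).
  + exact: desc_refl.
  split; first exact: (delete_local T Hc).
  move=> f2 L2; rewrite (delete_at T Hc L L2) lx sx; apply: mk_perm.
  move: E; rewrite (delete_before T Hc L) fc => /mk_inj[_ _].
  by rewrite perm_cons.
- move=> Su lk lk' ck x Nx E; have [c Hc fc] := kidE _ _ _ _ Nx E.
  have [lx sx _] := mkE _ _ _ Nx E; have Nc := erel_r T Hc.
  have [t' [T' cf' dis Tf']] := conf_fresh t ck lk'.
  have pc := parent_edge T Hc.
  exists (Repl c t'), x; rewrite /= pc; split; first split=> //.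
  + exists (URepl A B B') => //; split; first by rewrite -(lbl_labeling L) // fc.
    split; first by exists x.
    by split=> //; have [_ [/eqP]] := Sv _ Su.
  + exact: (replace_tree T Hc T' dis).
  + exact: desc_refl.
  split; first exact: (replace_local T Hc T' dis).
  move=> f2 L2; have [f' L'] := labeling_ex T'.
  rewrite (replace_at T Hc L T' dis L' L2) Tf' // lx sx; apply: mk_perm.
  move: E; rewrite (delete_before T Hc L) fc => /mk_inj[_ _].
  by rewrite !perm_cons.
- move=> Su x Nx E; have [c Hc fc] := kidE _ _ _ _ Nx E.
  have [lx sx _] := mkE _ _ _ Nx E; have Nc := erel_r T Hc.
  have [lc c0] : lab t c = Str /\ children t c = [::].
    move: fc; rewrite L // => /mk_inj[-> _ /perm_size/=].
    by rewrite size_map => /size0nil.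
  exists (ReplS c s'), x; split; first split=> //.
  + by exists (UReplS A) => //; split=> //; exists x.
  + exact: setstr_tree.
  + exact: desc_refl.
  split; first exact: (setstr_local s' Hc).
  move=> f2 L2; rewrite (setstr_at T Hc L L2) (setstr_leaf T Hc L2) // lx sx.
  apply: mk_perm; move: E; rewrite (setstr_before T Hc L) fc => /mk_inj[_ _].
  by rewrite !perm_cons.
- move=> st IH x Nx E; have [c Hc fc] := kidE _ _ _ _ Nx E.
  have [lx sx _] := mkE _ _ _ Nx E; have Nc := erel_r T Hc.
  have [o [p [[V M T2 R2 dp] [loc H2]]]] := IH c Nc fc.
  exists o, p; split; first split=> //.
    exact: desc_trans (desc_edge Hc) dp.
  split=> // f2 L2.
  have [rest [_ E1 ->]] := local_above T L L2 loc Hc dp.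
  rewrite H2 // lx sx; apply: mk_perm; move: E; rewrite E1 fc => /mk_inj[_ _].
  by rewrite !perm_cons.
Qed.

End Local.

Hypothesis S_valid : forall u, S u -> valid_uat D u.

Lemma allowed_sound ops t f : tree_spec t -> labeling t f -> conf D (f (root t)) ->
  allowed D S t ops ->
  tree_spec (apply_seq ops t) /\ forall f2, labeling (apply_seq ops t) f2 ->
    steps D S (f (root t)) (f2 (root (apply_seq ops t))).
Proof.
elim: ops t f => [|o ops IH] t f T L c /=.
  (* Two labelings of the same tree agree at the root, by the identity isomorphism. *)
  move=> _; split=> // f2 L2; rewrite (iso_shape T T L L2); first exact: rt_refl.
  exact: iso_refl.
case=> V [M al]; have [T1 R1 st] := op_sound T L c V M.
have [f1 L1] := labeling_ex T1; have {}st := st _ L1.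
have c1 : conf D (f1 (root (apply o t))).
  by rewrite R1; apply: step_conf st c.
have [T2 H2] := IH _ _ T1 L1 c1 al; split=> // f2 /H2.
by rewrite R1; apply: rt_trans; apply: rt_step.
Qed.

Lemma steps_allowed U U' t f : tree_spec t -> labeling t f -> f (root t) = U ->
  steps D S U U' ->
  exists ops, [/\ allowed D S t ops, tree_spec (apply_seq ops t)
    & forall f2, labeling (apply_seq ops t) f2 -> f2 (root (apply_seq ops t)) = U'].
Proof.
move=> T L E /(@clos_rt_rt1n _ _ _ _) st; elim: st t f T L E => [V|V W Z st _ IH] t f T L E.
  exists [::]; split=> // f2 L2; rewrite -E; apply/esym; apply: (iso_shape T T L L2).
  exact: iso_refl.
rewrite -E in st.
have [o [p [[Vo M T1 R1 _] [_ H1]]]] := op_complete T L (ts_root T) st S_valid.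
have [f1 L1] := labeling_ex T1.
have [|ops [al T2 H2]] := IH _ _ T1 L1; first by rewrite R1 H1.
by exists (o :: ops).
Qed.

End Simulation.

(** * Contexts and witnesses of inconsistency *)

Section Forward.

Variable D : dtd.
Hypothesis wf : wf_dtd D.

Lemma kids_Ele A B : A \in Ele D -> B \in rhs_kids (Rg D A) -> B \in Ele D.
Proof.
case: wf => _ [wfr _] /wfr; case: (Rg D A) => //= [bs|bs|b].
- by case=> _ [_ /allP]; apply.
- by case=> _ [_ /allP]; apply.
- by move=> Hb; rewrite inE => /eqP->.
Qed.

Lemma conf_list bs :
  (forall b, b \in bs -> exists2 U, lbl U = El b & conf D U) ->
  exists2 ks, map lbl ks = map El bs & forall k, k \in ks -> conf D k.
Proof.
elim: bs => [|b bs IH] H; first by exists [::].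
have [U lU cU] := H b (mem_head _ _).
have [c Hc|ks E cks] := IH; first by apply: H; rewrite inE Hc orbT.
exists (U :: ks); first by rewrite /= lU E.
by move=> k; rewrite inE => /predU1P[->|/cks].
Qed.

Lemma conf_ex A : A \in Ele D -> exists2 U, lbl U = El A & conf D U.
Proof.
(* V lists the element types strictly above A; acyclicity bounds its length. *)
suff key n (V : seq nat) B : B \in Ele D -> uniq V -> {subset V <= Ele D} ->
    (forall C, C \in V -> clos_trans nat (subel D) C B) -> size (Ele D) < n + size V ->
    exists2 U, lbl U = El B & conf D U.
  by move=> HA; apply: (key (size (Ele D)).+1 [::]); rewrite ?addn0.
case: wf => _ [wfr [acyc _]].
elim: n V B => [|n IH] V B HB uV sV above.
  by rewrite ltnNge (uniq_leq_size uV sV).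
move=> sz; have kids C : C \in rhs_kids (Rg D B) -> exists2 U, lbl U = El C & conf D U.
  move=> HC; apply: (IH (B :: V)).
  - exact: kids_Ele HC.
  - by rewrite /= uV andbT; apply/negP=> /above/acyc.
  - by move=> E; rewrite inE => /predU1P[->|/sV].
  - have BC : clos_trans nat (subel D) B C by apply: t_step.
    by move=> E; rewrite inE => /predU1P[-> //|/above CB]; apply: t_trans CB BC.
  - by rewrite /= addnS -addSn.
have build ks : word_ok (Rg D B) (map lbl ks) -> (forall k, k \in ks -> conf D k) ->
    exists2 U, lbl U = El B & conf D U.
  by move=> w c; exists (nd B ks); [rewrite lbl_mk | apply: ConfEl].
have := wfr B HB; case ER: (Rg D B) kids build => [||bs|bs|b] /= kids build.
- move=> _; apply: (build [:: leaf 0]); first by rewrite /= lbl_mk.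
  by move=> k; rewrite inE => /eqP->; exact: ConfStr.
- by move=> _; apply: (build [::]).
- by move=> _; have [ks E c] := conf_list kids; apply: (build ks); rewrite ?E.
- case: bs {ER} kids build => [|b bs] kids build [] // _ _.
  have [U lU cU] := kids b (mem_head _ _).
  apply: (build [:: U]) => /=; first by exists b; rewrite ?mem_head ?lU.
  by move=> k; rewrite inE => /eqP->.
- by move=> _; apply: (build [::]).
Qed.

(** Injectivity of [plug] keeps a non-trivial step non-trivial in context. *)
Definition context X Y (plug : utree -> utree) := [/\
  forall V, lbl V = El Y -> conf D V -> lbl (plug V) = El X /\ conf D (plug V),
  forall S V V', step D S V V' -> step D S (plug V) (plug V') & injective plug].

Lemma context_steps X Y plug S V V' : context X Y plug ->
  steps D S V V' -> steps D S (plug V) (plug V').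
Proof.
case=> _ H _; elim=> [a b /H st|a|a b c _ Hab _ Hbc]; first exact: rt_step.
  exact: rt_refl.
exact: rt_trans Hab Hbc.
Qed.

Lemma context_ex X Y : leD D X Y -> exists plug, context X Y plug.
Proof.
elim=> [A B [HA HB]|A|A B C _ [g [g1 g2 g3]] _ [h [h1 h2 h3]]]; first 1 last.
- by exists id; split.
- exists (g \o h); split=> /=.
  + by move=> V lV cV; have [lh ch] := h1 V lV cV; exact: g1.
  + by move=> S V V' /h2/g2.
  + exact: inj_comp.
(* The hole gets conforming siblings that complete the word of [Rg D A]: one for each other type in
   a concatenation, none otherwise. *)
have [sibs Hw cs] : exists2 ks, (forall V, lbl V = El B ->
    word_ok (Rg D A) (map lbl (V :: ks))) & forall k, k \in ks -> conf D k.
  have kidsE := @kids_Ele A _ HA; case: (Rg D A) kidsE HB => //= [bs|bs|b] kidsE HB.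
  - have [b /mem_rem/kidsE/conf_ex //|ks E cks] := @conf_list (rem B bs).
    exists ks => // V ->; rewrite E -map_cons; apply: perm_map.
    by rewrite perm_sym perm_to_rem.
  - by exists [::] => // V lV; exists B; rewrite ?lV.
  - exists [::] => // V lV; rewrite /= lV andbT.
    by move: HB; rewrite inE => /eqP->.
exists (fun V => nd A (V :: sibs)); split.
- move=> V lV cV; split; first by rewrite lbl_mk.
  apply: ConfEl => //; first exact: Hw.
  by move=> k; rewrite inE => /predU1P[->|/cs].
- by move=> S V V'; exact: StepCtx.
- move=> V V' /mk_inj[_ _ P].
  have : perm_eq ([:: V] ++ sibs) ([:: V'] ++ sibs) := P.
  by rewrite perm_cat2r => /perm_eq_seq1[].
Qed.

(** Every valid UAT has a non-trivial instance; [eq u] is the singleton set of UATs. *)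
Lemma uat_step u : valid_uat D u -> exists U U',
  [/\ lbl U = El (uat_el u), conf D U, step D (eq u) U U' & U <> U'].
Proof.
case: u => [A B|A B|A B B'|A] /= [HA].
- move=> HR; have [k lk ck] : exists2 U, lbl U = El B & conf D U.
    by apply: conf_ex; apply: kids_Ele HA _; rewrite HR mem_head.
  exists (nd A [::]), (nd A [:: k]); split; rewrite ?lbl_mk //.
  + by apply: ConfEl => //; rewrite HR.
  + exact: (StepIns (B := B)).
- move=> HR; have [k lk ck] : exists2 U, lbl U = El B & conf D U.
    by apply: conf_ex; apply: kids_Ele HA _; rewrite HR mem_head.
  exists (nd A [:: k]), (nd A [::]); split; rewrite ?lbl_mk //.
  + apply: ConfEl => //; first by rewrite HR /= lk eqxx.
    by move=> k'; rewrite inE => /eqP->.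
  + exact: (@StepDel _ _ A B).
- case=> ne [bs HR /andP[Bbs B'bs]].
  have kid C : C \in bs -> exists2 U, lbl U = El C & conf D U.
    by move=> HC; apply: conf_ex; apply: kids_Ele HA _; rewrite HR.
  have [k lk ck] := kid B Bbs; have [k' lk' ck'] := kid B' B'bs.
  exists (nd A [:: k]), (nd A [:: k']); split; rewrite ?lbl_mk //.
  + apply: ConfEl => //; first by rewrite HR /= lk; exists B.
    by move=> k0; rewrite inE => /eqP->.
  + exact: (StepRepl (B := B) (B' := B')).
  + case/mk_inj=> _ _ /perm_eq_seq1[E]; move: lk'; rewrite -E lk => -[EB].
    by rewrite EB eqxx in ne.
- move=> HR; exists (nd A [:: leaf 0]), (nd A [:: leaf 1]); split; rewrite ?lbl_mk //.
  + by apply: ConfEl; rewrite ?HR //= => k; rewrite inE => /eqP->; exact: ConfStr.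
  + exact: StepStr.
Qed.

Lemma uat_step_below u B : valid_uat D u -> leD D B (uat_el u) -> exists U U',
  [/\ lbl U = El B /\ conf D U, lbl U' = El B /\ conf D U', step D (eq u) U U' & U <> U'].
Proof.
move=> vu /context_ex[g gc]; have [U [U' [lU cU st ne]]] := uat_step vu.
have [g1 g2 g3] := gc.
have cU' : conf D U' by apply: step_conf st cU => _ <-.
exists (g U), (g U'); split; [exact: g1 | | exact: g2 | by move/g3].
by apply: g1 => //; rewrite (step_lbl st).
Qed.

Variables (Aset Fset : uat -> Prop).
Hypotheses (A_valid : forall u, Aset u -> valid_uat D u)
  (F_valid : forall u, Fset u -> valid_uat D u).

Lemma consistent_rt U U' : consistent D Aset Fset ->
  lbl U = El (rt D) -> conf D U -> step D Fset U U' -> U <> U' ->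
  ~ steps D Aset U U'.
Proof.
move=> cons lU cU st ne sts; apply: cons.
have [t [T Tf _]] := conf_realizes cU 0; have [f L] := labeling_ex T.
have fU := Tf _ L.
have [ops [al T1 H1]] := steps_allowed A_valid T L fU sts.
rewrite -fU in st; have [o [p [[V M T2 R2 _] [_ H2]]]] := op_complete T L (ts_root T) st F_valid.
have [f1 L1] := labeling_ex T1; have [f2 L2] := labeling_ex T2.
exists t, ops, o; split; [|split; [|split=> //; split=> //; split=> //; split]].
- by apply/(conformsP D T L); rewrite -(lbl_labeling L (ts_root T)) fU.
(* An empty sequence would leave the canonical form unchanged and force [U = U']. *)
- move=> E; apply: ne; rewrite -(H1 _ L1); move: (T1) (L1); rewrite E /= => T1' L1'.
  by rewrite -fU; apply: (iso_shape T T1' L L1'); exact: iso_refl.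
- by move=> /(iso_shape T2 T L2 L); rewrite R2 (H2 _ L2) fU => /esym.
- by apply: (shape_iso T1 T2 L1 L2); rewrite (H1 _ L1) R2 (H2 _ L2).
Qed.

Lemma consistent_at A U U' : consistent D Aset Fset ->
  lbl U = El A -> A \in Ele D -> conf D U -> step D Fset U U' -> U <> U' ->
  ~ steps D Aset U U'.
Proof.
move=> cons lU HA cU st ne sts; have [_ [_ [_ reach]]] := wf.
have [g gc] := context_ex (reach A HA); have [g1 g2 g3] := gc.
have [lg cg] := g1 U lU cU.
by apply: (consistent_rt cons lg cg (g2 _ _ _ st) _ (context_steps gc sts)) => /g3.
Qed.

(** The last replacement may insert any tree of type [Bj]; along a cycle, a subtree is thus
    exchanged for an arbitrary one of the same type. *)
Lemma replace_steps A bs Bi Bj V V' : A \in Ele D -> Rg D A = RDisj bs ->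
  clos_trans nat (replace_edge D Aset A) Bi Bj ->
  lbl V = El Bi -> lbl V' = El Bj -> conf D V' ->
  steps D Aset (nd A [:: V]) (nd A [:: V']).
Proof.
move=> HA HR HG; elim: HG V V' => [B C [_ HS]|B C E HBC IH1 _ IH2] V V' lV lV' cV'.
  by apply: rt_step; apply: StepRepl HS lV lV' cV'.
have HC : C \in Ele D.
  apply: kids_Ele HA _; elim: HBC => // X Y [[bs' -> /andP[_ H]] _] //.
have [W lW cW] := conf_ex HC.
apply: rt_trans (IH1 V W lV lW cW) (IH2 W V' lW lV' cV').
Qed.

(** Deleting [U] and inserting [U'] imitates a forbidden step inside the child [U]. *)
Lemma consistent_insdel A B : consistent D Aset Fset -> A \in Ele D -> Rg D A = RStar B ->
  Aset (UIns A B) -> Aset (UDel A B) -> nothing_forbidden_below D Fset B.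
Proof.
move=> cons HA HR HI HD u Fu /(uat_step_below (F_valid Fu))[U [U' [[lU cU] [lU' cU'] st ne]]].
apply: (@consistent_at A (nd A [:: U]) (nd A [:: U']) cons); rewrite ?lbl_mk //.
- apply: ConfEl => //; first by rewrite HR /= lU eqxx.
  by move=> k; rewrite inE => /eqP->.
- by apply: StepCtx; apply: step_mono st => _ <-.
- by case/mk_inj=> _ _ /perm_eq_seq1[].
- apply: (rt_trans _ _ _ (nd A [::])); apply: rt_step.
    exact: StepDel HD lU.
  exact: StepIns HI lU' cU'.
Qed.

Lemma consistent_repl A bs Bi Bj : consistent D Aset Fset -> A \in Ele D ->
  Rg D A = RDisj bs -> clos_trans nat (replace_edge D Aset A) Bi Bj ->
  ~ Fset (URepl A Bi Bj).
Proof.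
move=> cons HA HR HG Fu; have [_ [ne [bs' HR' /andP[Hi Hj]]]] := F_valid Fu.
have kid C : C \in bs' -> exists2 U, lbl U = El C & conf D U.
  by move=> HC; apply: conf_ex; apply: kids_Ele HA _; rewrite HR'.
have [U lU cU] := kid Bi Hi; have [U' lU' cU'] := kid Bj Hj.
apply: (@consistent_at A (nd A [:: U]) (nd A [:: U']) cons); rewrite ?lbl_mk //.
- apply: ConfEl => //; first by rewrite HR' /= lU; exists Bi.
  by move=> k; rewrite inE => /eqP->.
- exact: StepRepl Fu lU lU' cU'.
- case/mk_inj=> _ _ /perm_eq_seq1[E]; move: lU'; rewrite -E lU => -[EB].
  by rewrite EB eqxx in ne.
- exact: replace_steps HR HG lU lU' cU'.
Qed.

Lemma consistent_cycle A bs Bi : consistent D Aset Fset -> A \in Ele D ->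
  Rg D A = RDisj bs -> Bi \in bs -> clos_trans nat (replace_edge D Aset A) Bi Bi ->
  nothing_forbidden_below D Fset Bi.
Proof.
move=> cons HA HR Hi HG u Fu.
move=> /(uat_step_below (F_valid Fu))[U [U' [[lU cU] [lU' cU'] st ne]]].
apply: (@consistent_at A (nd A [:: U]) (nd A [:: U']) cons); rewrite ?lbl_mk //.
- apply: ConfEl => //; first by rewrite HR /= lU; exists Bi.
  by move=> k; rewrite inE => /eqP->.
- by apply: StepCtx; apply: step_mono st => _ <-.
- by case/mk_inj=> _ _ /perm_eq_seq1[].
- exact: replace_steps HR HG lU lU' cU'.
Qed.

End Forward.

Theorem theorem1 (D : dtd) (Aset Fset : uat -> Prop) :
  wf_dtd D -> policy D Aset Fset ->
  consistent D Aset Fset <->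
  [/\ (* (1) *)
      (forall A B, A \in Ele D -> Rg D A = RStar B ->
         Aset (UIns A B) -> Aset (UDel A B) ->
         nothing_forbidden_below D Fset B),
      (* (2) *)
      (forall A bs, A \in Ele D -> Rg D A = RDisj bs ->
         forall Bi Bj, clos_trans nat (replace_edge D Aset A) Bi Bj ->
         ~ Fset (URepl A Bi Bj))
    & (* (3) *)
      (forall A bs, A \in Ele D -> Rg D A = RDisj bs ->
         forall Bi, Bi \in bs -> clos_trans nat (replace_edge D Aset A) Bi Bi ->
         nothing_forbidden_below D Fset Bi)].
Proof.
move=> wf [A_valid [F_valid AF_disj]]; split=> [cons|[C1 C2 C3]].
  split=> [A B|A bs HA HR Bi Bj|A bs HA HR Bi].
  - exact: consistent_insdel.
  - exact: consistent_repl HR.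
  - exact: consistent_cycle HR.
case=> t [ops [o [cf [_ [al [V [M [nt eqv]]]]]]]].
have T : tree_spec t by apply/is_treeP; case: cf.
have [f L] := labeling_ex T; move/(conformsP D T L): cf => [_ c].
have [T2 R2 st] := op_sound T L c V M; have [f2 L2] := labeling_ex T2.
have [T1 H1] := allowed_sound A_valid T L c al; have [f1 L1] := labeling_ex T1.
apply: (no_forbidden_steps A_valid F_valid AF_disj C1 C2 C3 c (st _ L2)).
  (* Equal forms would make the forbidden update trivial up to isomorphism. *)
  by move=> E; apply: nt; apply: (shape_iso T2 T L2 L); rewrite R2 E.
by have := H1 _ L1; rewrite (iso_shape T1 T2 L1 L2 eqv) R2.
Qed.
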